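(* Let $n\ge1$. Each $\mathcal F_n^\pm(d)$, $d\in\mathbb Z$, is invariant under the $\pi_{nl}$ action restricted to $SU(2)\times SU(2)$, and we have the following decomposition into irreducible components: $$\mathcal F_n^+(2l)=V_l\boxtimes V_{l+\frac n2},\qquad\mathcal F_n^+(d)=\{0\}\ \text{ if }d<0,$$ $$\mathcal F_n^-(-2l-n-2)=V_{l+\frac n2}\boxtimes V_l,\qquad\mathcal F_n^-(d)=\{0\}\ \text{ if }d>-(n+2),$$ $l=0,\frac12,1,\frac32,\dots$. Similarly, each $\mathcal G_n^\pm(d)$ is invariant under the $\pi_{nr}$ action restricted to $SU(2)\times SU(2)$, and we have the following decomposition into irreducible components: $$\mathcal G_n^+(2l)=V_{l+\frac n2}\boxtimes V_l,\qquad\mathcal G_n^+(d)=\{0\}\ \text{ if }d<0,$$ $$\mathcal G_n^-(-2l-n-2)=V_l\boxtimes V_{l+\frac n2},\qquad\mathcal G_n^-(d)=\{0\}\ \text{ if }d>-(n+2),$$ $l=0,\frac12,1,\frac32,\dots$.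
   Context: $\mathbb H_{\mathbb C}=\mathbb C\otimes_{\mathbb R}\mathbb H$ is identified with complex $2\times2$ matrices $Z=(z_{ij})$, with the real quaternions $\mathbb H$ being the matrices $\begin{pmatrix}\alpha&-\bar\beta\\\beta&\bar\alpha\end{pmatrix}$, $\alpha,\beta\in\mathbb C$; $N(Z)=\det Z$; $\mathbb H_{\mathbb C}^\times=\{N(Z)\ne0\}$. $\mathbb S$, $\mathbb S'$ are the spaces $\mathbb C^2$ of columns and rows; their $n$-fold tensor powers are left, resp. right, modules over $\mathbb H_{\mathbb C}^{\otimes n}$. $SU(2)\times SU(2)$ consists of the elements $h=\begin{pmatrix}a&0\\0&d\end{pmatrix}$, $a,d\in\mathbb H$, $N(a)=N(d)=1$ (first factor: $a$; second factor: $d$), acting by $(\pi_{nl}(h)f)(Z)=(d\otimes\cdots\otimes d)f(a^{-1}Zd)$ and $(\pi_{nr}(h)g)(Z)=g(a^{-1}Zd)(a^{-1}\otimes\cdots\otimes a^{-1})$. $V_l$ is the irreducible $(2l+1)$-dimensional representation of $SU(2)$, and $\boxtimes$ is the external tensor product (first factor of the product acts on the first tensorand); equality means isomorphism of representations. For $l\in\{0,\frac12,1,\dots\}$, $\mu,\nu\in\mathbb Z+l$, $-l\le\mu,\nu\le l$, let $t^l_{\nu\,\underline\mu}(Z)=\frac1{2\pi i}\oint(sz_{11}+z_{21})^{l-\mu}(sz_{12}+z_{22})^{l+\mu}s^{-l+\nu}\frac{ds}s$ (loop once counterclockwise around $0$), a polynomial in $Z$; $\partial_{ij}=\partial/\partial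 z_{ij}$. For $l=0,\frac12,1,\dots$, $\mu\in\mathbb Z+l+\frac n2$, $-l-\frac n2\le\mu\le l+\frac n2$, $\nu\in\mathbb Z+l$, $-l\le\nu\le l$: $$F^{(n)}_{l,\mu,\nu}(Z)=\begin{pmatrix}\partial_{11}\\\partial_{12}\end{pmatrix}^{\otimes n}t^{l+n/2}_{\nu-n/2\,\underline\mu}(Z),\qquad G^{(n)}_{l,\mu,\nu}(Z)=\frac{(l-\nu)!}{(l-\nu+n)!}(\partial_{11},\partial_{21})^{\otimes n}\,t^{l+n/2}_{\mu\,\underline{\nu-n/2}}(Z);$$ $F'^{(n)}_{l,\mu,\nu}$ (column) and $G'^{(n)}_{l,\mu,\nu}$ (row) are the functions on $\mathbb H_{\mathbb C}^\times$ having at the tensor index $(i_1,\dots,i_n)\in\{1,2\}^n$, with $p$ indices equal to $1$ and $q=n-p$ equal to $2$, the respective entries $$\frac{(l-\nu+p)!}{(l-\nu)!}\frac{(l+\nu+q)!}{(l+\nu)!}N(Z)^{-1}t^{l+n/2}_{\nu+(q-p)/2\,\underline\mu}(Z^{-1}),\qquad N(Z)^{-1}t^{l+n/2}_{\mu\,\underline{\nu+(q-p)/2}}(Z^{-1}).$$ $\mathcal F_n^+,\mathcal F_n^-,\mathcal G_n^+,\mathcal G_n^-$ are the $\mathbb C$-spans of all $F^{(n)}_{l,\mu,\nu}$, $F'^{(n)}_{l,\mu,\nu}$, $G^{(n)}_{l,\mu,\nu}$, $G'^{(n)}_{l,\mu,\nu}$ respectively, and $\mathcal F_n^\pm(d)$,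 $\mathcal G_n^\pm(d)$ denote the subspaces of functions homogeneous of degree $d$. *)

(* Defs.v *)
(* MathComp-Analysis.  The complex numbers are [R[i]] over an arbitrary
   [R : realType]. *)
From HB Require Import structures.
From mathcomp Require Import all_boot all_order all_algebra complex.
From mathcomp Require Import all_classical all_reals all_analysis.

Set Implicit Arguments.
Unset Strict Implicit.
Unset Printing Implicit Defensive.

Import Order.TTheory GRing.Theory Num.Theory numFieldNormedType.Exports.

Local Open Scope classical_set_scope.
Local Open Scope ring_scope.
Local Open Scope complex_scope.

(* Conventions.
   - Complexified quaternions are 'M[R[i]]_2 and N is \det.  The matrix and
     tensor indices 1, 2 are 0, 1 : 'I_2.
   - Half-integers are never used as such: l is given by m = 2l : nat, and an
     index nu in {-l, ..., l} by the natural number l - nu in {0, ..., m}.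
   - A function on {Z | N(Z) <> 0} is represented by its extension by 0 to all
     of 'M[R[i]]_2. *)

(* The n-th tensor power of C^2 by coordinates; it serves for columns as well as
   for rows. *)
Notation tens R n := {ffun n.-tuple 'I_2 -> R[i]^o}.

Section Representations.
Variable R : realType.
Local Notation C := (R[i]).

Definition quaternion : set 'M[C]_2 :=
  [set Z : 'M[C]_2 | exists alpha beta : C,
     [/\ Z 0 0 = alpha, Z 0 1 = - (beta^*)%C,
         Z 1 0 = beta & Z 1 1 = (alpha^*)%C]].

Definition SU2 : set 'M[C]_2 := [set a : 'M[C]_2 | quaternion a /\ \det a = 1].

(* V_l with m = 2l, the irreducible representation of SU(2) of dimension m + 1,
   realized as the space of binary forms of degree m on which g acts by
   (g p)(v) = p (v *m g), v = (x, y) a row vector.  This is the matrix of g in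
   the basis x^k y^(m-k), 0 <= k <= m: column k holds the coefficients of
   (g00 x + g10 y)^k (g01 x + g11 y)^(m-k), read off at y = 1. *)
Definition Vrep (m : nat) (g : 'M[C]_2) : 'M[C]_m.+1 :=
  \matrix_(j, k) (((g 0 0 *: 'X + (g 1 0)%:P) ^+ k *
                   (g 0 1 *: 'X + (g 1 1)%:P) ^+ (m - k)) : {poly C})`_j.

(* The external tensor product of V_(m1/2) and V_(m2/2), on matrices: the pure
   tensor v (x) w of columns is v *m w^T. *)
Definition boxtimes_act (m1 m2 : nat) (a d : 'M[C]_2)
    (X : 'M[C]_(m1.+1, m2.+1)) : 'M[C]_(m1.+1, m2.+1) :=
  Vrep m1 a *m X *m (Vrep m2 d)^T.

Definition tensl (n : nat) (d : 'M[C]_2) (v : tens R n) : tens R n :=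
  [ffun I => \sum_(J : n.-tuple 'I_2)
     (\prod_(k < n) d (tnth I k) (tnth J k)) * v J].

Definition tensr (n : nat) (v : tens R n) (a : 'M[C]_2) : tens R n :=
  [ffun J => \sum_(I : n.-tuple 'I_2)
     v I * (\prod_(k < n) a (tnth I k) (tnth J k))].

Definition pi_nl (n : nat) (a d : 'M[C]_2) (f : 'M[C]_2 -> tens R n) :
    'M[C]_2 -> tens R n :=
  fun Z => tensl d (f (invmx a *m Z *m d)).

Definition pi_nr (n : nat) (a d : 'M[C]_2) (g : 'M[C]_2 -> tens R n) :
    'M[C]_2 -> tens R n :=
  fun Z => tensr (g (invmx a *m Z *m d)) (invmx a).

Section Subrepresentations.
Variable V : lmodType C.
Variable act : 'M[C]_2 -> 'M[C]_2 -> V -> V.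

Definition linear_span (A : set V) : set V :=
  [set f | exists (k : nat) (c : 'I_k -> C) (g : 'I_k -> V),
     (forall i, A (g i)) /\ f = \sum_(i < k) c i *: g i].

Definition linear_subspace (U : set V) : Prop :=
  U 0 /\ forall (c : C) f g, U f -> U g -> U (c *: f + g).

Definition act_invariant (U : set V) : Prop :=
  forall a d, SU2 a -> SU2 d -> forall f, U f -> U (act a d f).

Definition irreducible_rep (U : set V) : Prop :=
  [/\ linear_subspace U, act_invariant U, U != [set 0] &
      forall W : set V, linear_subspace W -> act_invariant W -> W `<=` U ->
        W = [set 0] \/ W = U].

Definition iso_boxtimes (m1 m2 : nat) (U : set V) : Prop :=
  exists phi : {linear 'M[C]_(m1.+1, m2.+1) -> V},
    [/\ injective phi, range phi = U &
        forall a d, SU2 a -> SU2 d -> forall X,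
          phi (boxtimes_act a d X) = act a d (phi X)].

End Subrepresentations.

Definition homogeneous_part (n : nat) (U : set ('M[C]_2 -> tens R n)) (d : int) :
    set ('M[C]_2 -> tens R n) :=
  [set f | U f /\
     forall (c : C) (Z : 'M[C]_2), c != 0 -> f (c *: Z) = c ^ d *: f Z].

End Representations.

Section Functions.
Variable R : realType.
Local Notation C := (R[i]).

(* The integral of g over the unit circle, counterclockwise. *)
Definition circle_integral (g : C -> C) : C :=
  let u (x : R) : C := cos x +i* sin x in
  let h (x : R) : C := g (u x) * ('i%C * u x) in
  (\int[lebesgue_measure]_(x in `[0, 2 * pi]) complex.Re (h x)) +i*
  (\int[lebesgue_measure]_(x in `[0, 2 * pi]) complex.Im (h x)).

(* tcoef m i j is t^l_{nu, mu} with m = 2l, i = l - nu, j = l - mu. *)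
Definition tcoef (m i j : nat) (Z : 'M[C]_2) : C :=
  (2 * pi%:C * 'i%C)^-1 *
  circle_integral (fun s =>
    (s * Z 0 0 + Z 1 0) ^+ j * (s * Z 0 1 + Z 1 1) ^+ (m - j) * s ^- i / s).

Definition partial (i j : 'I_2) (f : 'M[C]_2 -> C^o) : 'M[C]_2 -> C^o :=
  fun Z => 'D_(delta_mx i j) f Z.

(* In the four families below m = 2l, i = l - nu and j = l + n/2 - mu, with
   0 <= i <= m and 0 <= j <= m + n. *)
Definition Fplus_fun (n m i j : nat) (Z : 'M[C]_2) : tens R n :=
  [ffun I : n.-tuple 'I_2 =>
     foldr (fun k => partial 0 k) (tcoef (m + n) (i + n) j) I Z].

Definition Gplus_fun (n m i j : nat) (Z : 'M[C]_2) : tens R n :=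
  [ffun I : n.-tuple 'I_2 =>
     (i`!%:R / (i + n)`!%:R) *
     foldr (fun k => partial k 0) (tcoef (m + n) j (i + n)) I Z].

(* Since 0^-1 = 0, the next two functions vanish where \det Z = 0. *)
Definition Fminus_fun (n m i j : nat) (Z : 'M[C]_2) : tens R n :=
  [ffun I : n.-tuple 'I_2 =>
     let p := count_mem 0 I in let q := (n - p)%N in
     ((i + p)`!%:R / i`!%:R) * ((m - i + q)`!%:R / (m - i)`!%:R) *
     (\det Z)^-1 * tcoef (m + n) (i + p) j (invmx Z)].

Definition Gminus_fun (n m i j : nat) (Z : 'M[C]_2) : tens R n :=
  [ffun I : n.-tuple 'I_2 =>
     let p := count_mem 0 I in
     (\det Z)^-1 * tcoef (m + n) j (i + p) (invmx Z)].

Definition family_span (n : nat)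
    (F : nat -> nat -> nat -> 'M[C]_2 -> tens R n) : set ('M[C]_2 -> tens R n) :=
  linear_span [set f | exists m i j,
    [/\ (i <= m)%N, (j <= m + n)%N & f = F m i j]].

Definition calFplus (n : nat) := family_span (@Fplus_fun n).
Definition calFminus (n : nat) := family_span (@Fminus_fun n).
Definition calGplus (n : nat) := family_span (@Gplus_fun n).
Definition calGminus (n : nat) := family_span (@Gminus_fun n).

End Functions.

Arguments pi_nl R n a d f Z : clear implicits.
Arguments pi_nr R n a d g Z : clear implicits.
Arguments calFplus R n f : clear implicits.
Arguments calFminus R n f : clear implicits.
Arguments calGplus R n f : clear implicits.
Arguments calGminus R n f : clear implicits.

(* Main.v *)
(* Write V_m(Z) for the matrix [Vrep m Z].  It is multiplicative in Z, and by
   the residue theorem its entries are the t^l_{nu mu}(Z) with m = 2l.  Let M_I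
   and N_I be the matrices of multiplication by x^p y^q and of
   (d/dx)^p (d/dy)^q on binary forms, p and q being the numbers of indices 1 and
   2 in I.  Then the four families consist of the entries of
     F^+ : V_m(Z) N_I,                G^+ : M_I V_m(Z),
     F^- : N(Z)^-1 N_I V_{m+n}(Z^-1), G^- : N(Z)^-1 V_{m+n}(Z^-1) M_I.
   As x and y (resp. d/dx and d/dy) span the standard representation, M_I and
   N_I commute with the group up to its action on the tensor index I, so each
   family transforms by one copy of V_m and one of V_{m+n} acting on the two
   sides of the matrix; self-duality of these representations brings this to the
   form of an external tensor product.  The latter is irreducible: a torus
   isolates a matrix unit of any nonzero element, and one rotation without zero
   entries then reaches all other matrix units.  Hence the intertwining map is
   injective as soon as it is nonzero. *)
Require Import Defs.
From HB Require Import structures.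
From mathcomp Require Import all_boot all_order all_algebra complex.
From mathcomp Require Import all_classical all_reals all_analysis.
From mathcomp Require Import ring zify.
Set Implicit Arguments.
Unset Strict Implicit.
Unset Printing Implicit Defensive.
Import Order.TTheory GRing.Theory Num.Theory numFieldNormedType.Exports.
Local Open Scope classical_set_scope.
Local Open Scope ring_scope.

(** * Binary forms and the symmetric powers of a 2 x 2 matrix *)

Section BinaryForms.
Variable R : realType.
Local Notation C := R[i].

(** A form with coefficient column [A] has the value [monomials m v *m A] at [v]; identities between
    matrices can thus be checked pointwise. *)
Definition monomials (m : nat) (v : 'rV[C]_2) : 'rV[C]_m.+1 :=
  \row_k (v 0 0 ^+ k * v 0 1 ^+ (m - k)).

Lemma poly_eq0_horner (p : {poly C}) : (forall x, p.[x] = 0) -> p = 0.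
Proof.
move=> p0; apply/eqP/negPn/negP => pn0.
(* In characteristic zero the integers below [size p] are distinct, which is one root too many. *)
have := @max_poly_roots _ p [seq i%:R | i <- iota 0 (size p)] pn0.
rewrite size_map size_iota ltnn => h; suff : false by []; apply: h.
- by apply/allP => x _; rewrite rootE p0.
- rewrite map_inj_uniq ?iota_uniq// => i j /eqP.
  by rewrite eqr_nat => /eqP.
Qed.

Lemma monomials_inj m r (A B : 'M[C]_(m.+1, r)) :
  (forall v, monomials m v *m A = monomials m v *m B) -> A = B.
Proof.
move=> AB; apply/matrixP => i k.
pose p : {poly C} := \poly_(j < m.+1) (A (inord j) k - B (inord j) k).
suff /(congr1 (fun q : {poly C} => q`_i)) : p = 0.
  by rewrite coef_poly ltn_ord inord_val coef0 => /eqP;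
    rewrite subr_eq0 => /eqP.
apply: poly_eq0_horner => x; rewrite horner_poly.
(* The points (x, 1) suffice: there the difference of the two forms is the polynomial [p]. *)
have /rowP/(_ k) := AB (\row_l if l == 0 then x else 1).
rewrite !mxE => /eqP; rewrite -subr_eq0 -sumrB => /eqP h; rewrite -[RHS]h.
apply: eq_bigr => j _; rewrite !mxE /= expr1n mulr1 inord_val mulrBl.
by congr (_ - _); exact: mulrC.
Qed.

Lemma monomials_inj2 m r (A B : 'M[C]_(m.+1, r.+1)) :
  (forall v w, monomials m v *m A *m (monomials r w)^T =
               monomials m v *m B *m (monomials r w)^T) -> A = B.
Proof.
move=> AB; apply: monomials_inj => v; apply: trmx_inj.
apply: monomials_inj => w; apply: trmx_inj.
by rewrite trmx_mul [RHS]trmx_mul !trmxK.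
Qed.

(** Induction step that adds one linear factor to a form. The size bound makes the coefficient of
    [p] at [m.+1] vanish, which the shorter sum omits. *)
Lemma monomials_linear_mul (m : nat) (v : 'rV[C]_2) (a b : C) (p : {poly C}) :
  (size p <= m.+1)%N ->
  \sum_(j < m.+2) v 0 0 ^+ j * v 0 1 ^+ (m.+1 - j) * ((a *: 'X + b%:P) * p)`_j =
  (v 0 0 * a + v 0 1 * b) *
  \sum_(j < m.+1) v 0 0 ^+ j * v 0 1 ^+ (m - j) * p`_j.
Proof.
move=> sp; rewrite mulrDl [RHS]mulrDl !mulr_sumr.
under eq_bigr => j _ do
  rewrite -(scalerAl a) !coefD coefZ coefXM coefCM mulrDr.
rewrite big_split /=; congr (_ + _).
- rewrite big_ord_recl /= mulr0 mulr0 add0r; apply: eq_bigr => j _.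
  by rewrite /= /bump /= add1n subSS exprS; ring.
- rewrite big_ord_recr /= (_ : p`_m.+1 = 0) ?nth_default// !mulr0 addr0.
  apply: eq_bigr => j _; rewrite /= subSn -1?ltnS// exprS; ring.
Qed.

Lemma size_linear_mul (a b : C) (p : {poly C}) :
  (size ((a *: 'X + b%:P) * p)%R <= (size p).+1)%N.
Proof.
apply: leq_trans (size_polyMleq _ _) _.
have : (size (a *: 'X + b%:P : {poly C})%R <= 2)%N.
  apply: leq_trans (size_polyD _ _) _; rewrite geq_max.
  rewrite (leq_trans (size_scale_leq _ _)) ?size_polyX//=.
  by rewrite (leq_trans (size_polyC_leq1 _)).
by rewrite -subn1 leq_subLR add1n -[(size p).+2]add2n leq_add2r.
Qed.

(** The size bound is carried along because adding a further linear factor requires it. *)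
Lemma linear_powers_mul (v : 'rV[C]_2) (a b c d : C) (k l : nat) :
  (size (((a *: 'X + b%:P) ^+ k * (c *: 'X + d%:P) ^+ l)%R : {poly C})
     <= (k + l).+1)%N /\
  \sum_(j < (k + l).+1) v 0 0 ^+ j * v 0 1 ^+ (k + l - j) *
     (((a *: 'X + b%:P) ^+ k * (c *: 'X + d%:P) ^+ l) : {poly C})`_j =
  (v 0 0 * a + v 0 1 * b) ^+ k * (v 0 0 * c + v 0 1 * d) ^+ l.
Proof.
elim: k => [|k [IHs IH]].
  rewrite expr0 mul1r add0n mul1r; elim: l => [|l [IHs IH]].
    rewrite !expr0 size_poly1; split => //.
    by rewrite big_ord1 !expr0 coef1 !mul1r.
  rewrite !exprS monomials_linear_mul// IH; split => //.
  exact: leq_trans (size_linear_mul _ _ _) _.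
rewrite !exprS -!mulrA addSn monomials_linear_mul// IH; split => //.
exact: leq_trans (size_linear_mul _ _ _) _.
Qed.

Lemma mulmx2E p q (A : 'M[C]_(p, 2)) (B : 'M[C]_(2, q)) i k :
  (A *m B) i k = A i 0 * B 0 k + A i 1 * B 1 k.
Proof.
rewrite mxE !big_ord_recl big_ord0 /= addr0.
by rewrite (_ : lift ord0 ord0 = 1)//; exact/val_inj.
Qed.

(** This is the rule (g p)(v) = p(v g) on the basis. Together with [monomials_inj] it reduces
    multiplicativity, the unit and the degree of [Vrep] to properties of v g. *)
Lemma monomials_Vrep m v (g : 'M[C]_2) :
  monomials m v *m Vrep m g = monomials m (v *m g).
Proof.
apply/rowP => k; rewrite [RHS]mxE !mulmx2E mxE.
have km : (k + (m - k) = m)%N by rewrite subnKC// -ltnS.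
have [_] := linear_powers_mul v (g 0 0) (g 1 0) (g 0 1) (g 1 1) k (m - k).
by rewrite km => <-; apply: eq_bigr => j _; rewrite !mxE.
Qed.

Lemma VrepM m (g h : 'M[C]_2) : Vrep m (g *m h) = Vrep m g *m Vrep m h.
Proof. by apply: monomials_inj => v; rewrite mulmxA !monomials_Vrep mulmxA. Qed.

Lemma Vrep1 m : Vrep m (1%:M : 'M[C]_2) = 1%:M.
Proof. by apply: monomials_inj => v; rewrite monomials_Vrep !mulmx1. Qed.

Lemma monomialsZ m (c : C) v : monomials m (c *: v) = c ^+ m *: monomials m v.
Proof.
apply/rowP => k; rewrite !mxE !exprMn.
have -> : c ^+ m = c ^+ k * c ^+ (m - k) by rewrite -exprD subnKC// -ltnS.
ring.
Qed.

Lemma VrepZ m (c : C) (g : 'M[C]_2) : Vrep m (c *: g) = c ^+ m *: Vrep m g.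
Proof.
apply: monomials_inj => v.
by rewrite -scalemxAr !monomials_Vrep -monomialsZ scalemxAr.
Qed.

Lemma Vrep_unit m (g : 'M[C]_2) : g \in unitmx -> Vrep m g \in unitmx.
Proof.
by move=> gu; have := congr1 (Vrep m) (mulmxV gu); rewrite VrepM Vrep1 =>
  /mulmx1_unit[].
Qed.

(** Coefficients of (v w^T)^m in the monomials of v and w. *)
Definition binomial_mx (m : nat) : 'M[C]_m.+1 := diag_mx (\row_k 'C(m, k)%:R).

Definition cobinomial_mx (m : nat) : 'M[C]_m.+1 :=
  diag_mx (\row_k ('C(m, k)%:R)^-1).

Lemma binom_neq0 m (k : 'I_m.+1) : 'C(m, k)%:R != 0 :> C.
Proof. by rewrite pnatr_eq0 -lt0n bin_gt0 -ltnS. Qed.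

Lemma binomial_mxK m : binomial_mx m *m cobinomial_mx m = 1%:M.
Proof.
rewrite mulmx_diag -diag_const_mx; congr diag_mx; apply/rowP => k.
by rewrite !mxE divff// binom_neq0.
Qed.

Lemma cobinomial_mxK m : cobinomial_mx m *m binomial_mx m = 1%:M.
Proof. exact/mulmx1C/binomial_mxK. Qed.

(* Both sides are the coefficients of (v g w^T)^m, which is unchanged under
   g <-> g^T, v <-> w. *)
Lemma Vrep_tr m (g : 'M[C]_2) :
  Vrep m g *m binomial_mx m = (Vrep m g^T *m binomial_mx m)^T.
Proof.
have gen (h : 'M[C]_2) (v w : 'rV[C]_2) :
    (monomials m v *m (Vrep m h *m binomial_mx m) *m (monomials m w)^T) 0 0
    = ((v *m h *m w^T) 0 0) ^+ m.
  rewrite mulmxA monomials_Vrep.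
  set u := v *m h; clearbody u.
  rewrite mul_mx_diag mulmx2E mxE addrC exprDn.
  apply: eq_bigr => k _; rewrite !mxE !exprMn -mulr_natr; ring.
have tr00 (A : 'M[C]_1) : A 0 0 = A^T 0 0 by rewrite mxE.
apply: monomials_inj2 => v w; apply/matrixP => i j; rewrite !ord1 gen.
rewrite [RHS]tr00 trmx_mul [(_ *m _^T)^T]trmx_mul !trmxK mulmxA gen.
by rewrite tr00 trmx_mul [(_ *m _)^T]trmx_mul trmxK mulmxA.
Qed.

End BinaryForms.

(** * Self-duality, and equivariance of multiplication and differentiation *)

Section Equivariance.
Variable R : realType.
Local Notation C := R[i].

Lemma Vrep_trE m (g : 'M[C]_2) :
  (Vrep m g)^T = cobinomial_mx R m *m Vrep m g^T *m binomial_mx R m.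
Proof.
by rewrite -mulmxA Vrep_tr trmxK trmx_mul tr_diag_mx mulmxA cobinomial_mxK
  mul1mx.
Qed.

Definition symplectic_mx : 'M[C]_2 :=
  \matrix_(i, j) if i == j then 0 else if i == 0 then 1 else -1.

Lemma det_mx2E (A : 'M[C]_2) : \det A = A 0 0 * A 1 1 - A 0 1 * A 1 0.
Proof.
rewrite (expand_det_row _ 0) big_ord_recl big_ord1.
rewrite /cofactor !det_mx11 !mxE /= expr0 mul1r expr1 mulN1r mulrN.
by congr (A _ _ * A _ _ - A _ _ * A _ _); exact/val_inj.
Qed.

Lemma ord2P (i : 'I_2) : i = 0 \/ i = 1.
Proof. by case: i => -[|[|//]] ?; [left|right]; exact/val_inj. Qed.

Lemma mx2P (A B : 'M[C]_2) : A 0 0 = B 0 0 -> A 0 1 = B 0 1 ->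
  A 1 0 = B 1 0 -> A 1 1 = B 1 1 -> A = B.
Proof.
move=> ? ? ? ?; apply/matrixP => i j.
by case: (ord2P i) (ord2P j) => -> [] ->.
Qed.

Lemma det_symplectic : \det symplectic_mx = 1.
Proof. by rewrite det_mx2E !mxE /= mul0r mul1r opprK add0r. Qed.

(** SL(2) is the symplectic group of the plane: a^T J a = (det a) J for J = [symplectic_mx]. *)
Lemma tr_symplectic (a : 'M[C]_2) : \det a = 1 ->
  a^T *m symplectic_mx = symplectic_mx *m invmx a.
Proof.
move=> da; have ua : a \in unitmx by rewrite unitmxE da unitr1.
apply: (canRL (mulmxK ua)); rewrite det_mx2E in da.
by apply: mx2P; rewrite !mulmx2E !mxE /=; first [ring|rewrite -[in RHS]da;
  ring].
Qed.

(* SU(2) preserves a bilinear form on V_(m/2), so V_(m/2) is self-dual. *)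
Definition invariant_form m : 'M[C]_m.+1 :=
  cobinomial_mx R m *m Vrep m symplectic_mx.

Lemma invariant_form_unit m : invariant_form m \in unitmx.
Proof.
rewrite unitmx_mul Vrep_unit ?andbT; last first.
  by rewrite unitmxE det_symplectic unitr1.
by have /mulmx1_unit[] := cobinomial_mxK R m.
Qed.

(** Transposing [Vrep m a] gives [Vrep m a^T] between binomial matrices, which cancel against the
    first factor of the form; the symplectic matrix then carries [a^T] to the inverse of [a]. *)
Lemma invariant_formE m (a : 'M[C]_2) : \det a = 1 ->
  (Vrep m a)^T *m invariant_form m = invariant_form m *m Vrep m (invmx a).
Proof.
move=> da; rewrite Vrep_trE mulmxA -[_ *m binomial_mx R m *m _]mulmxA.
rewrite binomial_mxK mulmx1 -!mulmxA; congr (_ *m _).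
by rewrite -!VrepM tr_symplectic.
Qed.

Variable n : nat.
Implicit Types (I J : n.-tuple 'I_2).

(* The matrix of multiplication by x^p y^q, where p and q = n - p count the
   indices 0 and 1 in I. *)
Definition shift_mx m I : 'M[C]_((m + n).+1, m.+1) :=
  \matrix_(j, k) ((j : nat) == k + count_mem 0%R I)%N%:R.

(* The matrix of (d/dx)^p (d/dy)^q : the adjoint of [shift_mx] for the pairing
   in which x^k y^(m-k) has square norm k! (m-k)!. *)
Definition deriv_mx m I : 'M[C]_(m.+1, (m + n).+1) :=
  ((m + n)`!%:R / m`!%:R) *:
  (binomial_mx R m *m (shift_mx m I)^T *m cobinomial_mx R (m + n)).

(** A coordinate of the n-th tensor power of [v] depends on [I] only through its number of zeros,
    which is why [shift_mx] only counts them. *)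
Lemma prod_tuple2 (v : 'rV[C]_2) I :
  \prod_(k < n) v 0 (tnth I k) =
  v 0 0 ^+ count_mem 0%R I * v 0 1 ^+ (n - count_mem 0%R I).
Proof.
rewrite -(big_tuple _ _ I xpredT (fun i => v 0 i)) -{3}(size_tuple I).
elim: (tval I) => [|i s IH].
  by rewrite big_nil !expr0 mulr1.
rewrite big_cons IH /=; case: i => -[|[|//]] lti.
  rewrite (_ : Ordinal _ = 0); last exact/val_inj.
  by rewrite /= add1n subSS exprS mulrA.
rewrite (_ : Ordinal _ = 1); last exact/val_inj.
by rewrite /= add0n subSn ?count_size// exprS mulrCA.
Qed.

Lemma count0_le I : (count_mem 0%R I <= n)%N.
Proof. by rewrite -{2}(size_tuple I) count_size. Qed.

Lemma monomials_shift m (v : 'rV[C]_2) I :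
  monomials (m + n) v *m shift_mx m I =
  (\prod_(k < n) v 0 (tnth I k)) *: monomials m v.
Proof.
apply/rowP => k; rewrite prod_tuple2 !mxE; have pn := count0_le I.
have km : (k <= m)%N by rewrite -ltnS.
have lt : (k + count_mem 0%R I < (m + n).+1)%N by rewrite ltnS leq_add.
rewrite (bigD1 (Ordinal lt))//= big1 => [|j /eqP jk]; last first.
  rewrite !mxE; case: eqP => [e|_]; last by rewrite mulr0.
  by case: jk; exact/val_inj.
rewrite !mxE /= eqxx mulr1 addr0.
rewrite (_ : (m + n - (k + count_mem 0%R I) =
   (m - k) + (n - count_mem 0%R I))%N); last by lia.
by rewrite !exprD; ring.
Qed.

(** A product of sums expands over all functions from ['I_n] to ['I_2], which are then reindexed by
    tuples. *)
Lemma prod_mulmx_tuple (v : 'rV[C]_2) (g : 'M[C]_2) I :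
  \prod_(k < n) (v *m g) 0 (tnth I k) =
  \sum_J (\prod_(k < n) g (tnth J k) (tnth I k)) *
         (\prod_(k < n) v 0 (tnth J k)).
Proof.
under eq_bigr do rewrite mxE.
rewrite bigA_distr_bigA /=.
rewrite (reindex (fun J => [ffun k => tnth J k])) /=; last first.
  exists (fun f : {ffun 'I_n -> 'I_2} => [tuple f k | k < n]) => [J|f] _.
    by apply: eq_from_tnth => k; rewrite tnth_mktuple ffunE.
  by apply/ffunP => k; rewrite ffunE tnth_mktuple.
apply: eq_bigr => J _; rewrite -big_split; apply: eq_bigr => k _.
by rewrite ffunE mulrC.
Qed.

(** Evaluated at v, the left side multiplies by the coordinate at [I] of the tensor power of v g,
    and this coordinate is linear in those of the tensor power of v. *)
Lemma Vrep_shift m (g : 'M[C]_2) I :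
  Vrep (m + n) g *m shift_mx m I =
  \sum_J (\prod_(k < n) g (tnth J k) (tnth I k)) *: (shift_mx m J *m Vrep m g).
Proof.
apply: monomials_inj => v; rewrite mulmxA monomials_Vrep monomials_shift.
rewrite mulmx_sumr prod_mulmx_tuple scaler_suml; apply: eq_bigr => J _.
rewrite -scalemxAr mulmxA monomials_shift -scalemxAl monomials_Vrep.
by rewrite scalerA.
Qed.

(** Transpose of [Vrep_shift] for g^T; the binomial matrices in [deriv_mx] convert each transposed
    [Vrep] back. *)
Lemma deriv_Vrep m (g : 'M[C]_2) I :
  deriv_mx m I *m Vrep (m + n) g =
  \sum_J (\prod_(k < n) g (tnth I k) (tnth J k)) *: (Vrep m g *m deriv_mx m J).
Proof.
have trV k (h : 'M[C]_2) :
    cobinomial_mx R k *m Vrep k h = (Vrep k h^T)^T *m cobinomial_mx R k.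
  by rewrite Vrep_trE trmxK -[RHS]mulmxA binomial_mxK mulmx1.
have trV' k (h : 'M[C]_2) :
    binomial_mx R k *m (Vrep k h^T)^T = Vrep k h *m binomial_mx R k.
  by rewrite Vrep_trE trmxK !mulmxA binomial_mxK mul1mx.
rewrite /deriv_mx; set c := _ / _; rewrite -scalemxAl -mulmxA trV mulmxA -[_ *m
  _ *m (Vrep _ _)^T]mulmxA.
rewrite -trmx_mul Vrep_shift linear_sum mulmx_sumr mulmx_suml scaler_sumr.
apply: eq_bigr => J _; rewrite linearZ /= trmx_mul -scalemxAr -scalemxAl mulmxA.
rewrite trV' scalerA mulrC -scalerA -!scalemxAr !mulmxA; congr (_ *: _).
by apply: eq_bigr => k _; rewrite mxE.
Qed.

(** The quotient of binomial coefficients collapses to the factorials that differentiation produces,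
    which are also those in [Fminus_fun]. *)
Lemma deriv_mxE m I (k : 'I_m.+1) (j : 'I_(m + n).+1) :
  deriv_mx m I k j = ((j : nat) == k + count_mem 0%R I)%N%:R *
   (((k + count_mem 0%R I)`!%:R / k`!%:R) *
    ((m - k + (n - count_mem 0%R I))`!%:R / (m - k)`!%:R)).
Proof.
rewrite /deriv_mx mul_mx_diag mul_diag_mx !mxE; have pn := count0_le I.
have km : (k <= m)%N by rewrite -ltnS.
case: eqP => [jk|_]; last by rewrite mul0r mulr0 mul0r mulr0.
have f0 i : i`!%:R != 0 :> C by rewrite pnatr_eq0 -lt0n fact_gt0.
have := bin_fact km => /(congr1 (fun i => i%:R : C)).
have jm : (j <= m + n)%N by rewrite -ltnS.
have := bin_fact jm => /(congr1 (fun i => i%:R : C)).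
rewrite jk (_ : (m + n - (k + count_mem 0%R I) =
   (m - k) + (n - count_mem 0%R I))%N); last by lia.
rewrite !natrM => <- <-.
have := binom_neq0 R j; have := binom_neq0 R k; rewrite jk => b1 b2.
by field; rewrite b1 b2 !f0.
Qed.

End Equivariance.

(** * Irreducibility of the external tensor product *)

Section Irreducibility.
Variable R : realType.
Local Notation C := R[i].
Local Open Scope complex_scope.

Definition unit_circle (x : R) : C := cos x +i* sin x.

Lemma unit_circleX x k : unit_circle x ^+ k = unit_circle (k%:R * x).
Proof.
elim: k => [|k IH]; first by rewrite mul0r /unit_circle cos0 sin0.
rewrite exprS IH -natr1 mulrDl mul1r addrC /unit_circle cosD sinD.
by simpc; congr (_ +i* _); rewrite addrC.
Qed.

Lemma unit_circle_conj x : unit_circle x * unit_circle (- x) = 1.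
Proof.
rewrite /unit_circle cosN sinN; simpc.
by rewrite -!expr2 cos2Dsin2 [sin x * _]mulrC addNr.
Qed.

Lemma quaternionP (Z : 'M[C]_2) :
  Z 0 1 = - conjc (Z 1 0) -> Z 1 1 = conjc (Z 0 0) -> quaternion Z.
Proof. by move=> ? ?; exists (Z 0 0), (Z 1 0). Qed.

Definition torus_mx (x : R) : 'M[C]_2 :=
  \matrix_(i, j) if i != j then 0
                 else if i == 0 then unit_circle x else unit_circle (- x).

Lemma SU2_torus x : SU2 (torus_mx x).
Proof.
split; last by rewrite det_mx2E !mxE /= mul0r subr0 unit_circle_conj.
by apply: quaternionP; apply/eqP; rewrite !mxE eq_complex /= ?oppr0 ?cosN ?sinN
  !eqxx.
Qed.

Lemma SU2_1 : SU2 (1%:M : 'M[C]_2).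
Proof.
split; last exact: det1.
by apply: quaternionP; apply/eqP; rewrite !mxE eq_complex /= ?oppr0 !eqxx.
Qed.

Lemma Vrep_torus m x : Vrep m (torus_mx x) =
  diag_mx (\row_k (unit_circle x ^+ k * unit_circle (- x) ^+ (m - k))).
Proof.
apply: monomials_inj => v; rewrite monomials_Vrep mul_mx_diag.
apply/rowP => k; rewrite [LHS]mxE !mulmx2E !mxE /= !mulr0 addr0 add0r !exprMn.
by rewrite mulrACA.
Qed.

(** The weights are e^(i(2k-m)x). Multiplication by e^(imx) leaves the angles 2kx, and their cosines
    already differ if the angles lie in [0, pi]. *)
Lemma torus_weights_inj m : exists x : R, injective (fun k : 'I_m.+1 =>
  unit_circle x ^+ k * unit_circle (- x) ^+ (m - k)).
Proof.
(* With this choice 2kx = k pi / (m+1), which is at most pi for k <= m. *)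
pose x : R := pi / (2 * m.+1%:R); exists x => j k /(congr1 ( *%R (unit_circle x
  ^+ m))).
have shiftE (i : 'I_m.+1) : unit_circle x ^+ m *
    (unit_circle x ^+ i * unit_circle (- x) ^+ (m - i)) =
    unit_circle ((2 * i)%:R * x).
  have -> : unit_circle x ^+ m = unit_circle x ^+ i * unit_circle x ^+ (m - i).
    by rewrite -exprD subnKC// -ltnS.
  rewrite mulrACA -[_ * unit_circle (- x) ^+ _]exprMn unit_circle_conj expr1n
    mulr1 -exprD unit_circleX.
  by rewrite addnn -mul2n.
rewrite !shiftE => -[+ _].
have in0pi (i : 'I_m.+1) : (2 * i)%:R * x \in `[0, pi]%R.
  have -> : (2 * i)%:R * x = i%:R / m.+1%:R * pi.
    rewrite /x natrM; have : m.+1%:R != 0 :> R by rewrite pnatr_eq0.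
    by move: (m.+1%:R) => q q0; field.
  rewrite in_itv /= mulr_ge0 ?divr_ge0 ?pi_ge0//=.
  by rewrite ler_piMl ?pi_ge0// ler_pdivrMr ?ltr0n// mul1r ler_nat ltnW.
move=> /cos_inj -/(_ (in0pi j) (in0pi k)) /mulIf.
rewrite /x mulf_neq0 ?invr_eq0 ?mulf_neq0 ?pnatr_eq0 ?gt_eqF ?pi_gt0//.
by move=> /(_ isT)/eqP; rewrite eqr_nat eqn_pmul2l// => /eqP/val_inj.
Qed.

(** The triangle with sides 3, 4, 5 gives a rotation with rational, nonzero entries. *)
Definition rotation345 : 'M[C]_2 :=
  \matrix_(i, j) if i == j then 3 / 5 else if i == 0 then - (4 / 5) else 4 / 5.

Lemma SU2_rotation345 : SU2 rotation345.
Proof.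
split; last by rewrite det_mx2E !mxE /=; field.
have c3 : ((3 / 5 : C)^*)%C = 3 / 5 by rewrite rmorphM fmorphV !rmorph_nat.
have c4 : ((4 / 5 : C)^*)%C = 4 / 5 by rewrite rmorphM fmorphV !rmorph_nat.
have r00 : rotation345 0 0 = 3 / 5 by rewrite mxE.
have r01 : rotation345 0 1 = - (4 / 5) by rewrite mxE.
have r10 : rotation345 1 0 = 4 / 5 by rewrite mxE.
have r11 : rotation345 1 1 = 3 / 5 by rewrite mxE.
by apply: quaternionP; rewrite !(r00, r01, r10, r11) ?c3 ?c4.

Qed.

(** Evaluation at v = (1, 0) picks out this row, since x^m is the only monomial that survives
    there. *)
Lemma Vrep_last_row m (g : 'M[C]_2) (k : 'I_m.+1) :
  Vrep m g ord_max k = g 0 0 ^+ k * g 0 1 ^+ (m - k).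
Proof.
pose v : 'rV[C]_2 := \row_i (i == 0)%:R.
have /rowP/(_ k) := monomials_Vrep m v g.
rewrite mxE (bigD1 ord_max)//= big1 => [|j jm]; last first.
  rewrite !mxE /= [0 ^+ _]expr0n subn_eq0 leqNgt.
  rewrite (_ : (j < m)%N) ?mulr0 ?mul0r//.
  by rewrite ltn_neqAle -ltnS ltn_ord andbT; apply: contra jm => /eqP jm;
    exact/eqP/val_inj.
by rewrite [monomials m _ 0 k]mxE !mulmx2E !mxE /= subnn !expr1n !mul1r !mul0r
  !addr0.
Qed.

Lemma Vrep_rotation_row m k : Vrep m rotation345 ord_max k != 0.
Proof.
rewrite Vrep_last_row !mxE /= mulf_neq0// expf_neq0 ?oppr_eq0//.
all: by rewrite mulf_neq0// ?invr_eq0 pnatr_eq0.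
Qed.

(** By [Vrep_trE] the last column is the last row for the transposed rotation, up to nonzero
    binomial factors. *)
Lemma Vrep_rotation_col m k : Vrep m rotation345 k ord_max != 0.
Proof.
have -> : Vrep m rotation345 k ord_max = (Vrep m rotation345)^T ord_max k.
  by rewrite [RHS]mxE.
rewrite Vrep_trE mul_mx_diag mxE mulf_neq0//; last by rewrite mxE binom_neq0.
rewrite mul_diag_mx mxE mulf_neq0//; first by rewrite mxE invr_eq0 binom_neq0.
rewrite Vrep_last_row !mxE /= mulf_neq0// expf_neq0//.
all: by rewrite mulf_neq0// ?invr_eq0 pnatr_eq0.
Qed.

(* Lagrange interpolation at the eigenvalues. *)
Lemma eigen_component (V : lmodType C) (W : set V) (T : V -> V) r
    (lam : 'I_r -> C) (v : 'I_r -> V) :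
  linear T -> injective lam -> (forall k, T (v k) = lam k *: v k) ->
  linear_subspace W -> (forall w, W w -> W (T w)) -> W (\sum_k v k) ->
  forall k, W (v k).
Proof.
move=> T_lin lam_inj Tv [W0 Wlin] WT Wv k.
pose T' : {linear V -> V} := HB.pack T (GRing.isLinear.Build _ _ _ _ T T_lin).
(* The sum is p(T) applied to the sum of the [v i], and [W] is stable under polynomials in [T]. *)
have Wp (p : {poly C}) : W (\sum_i p.[lam i] *: v i).
  elim/poly_ind: p => [|p c IH].
    by rewrite big1// => i _; rewrite horner0 scale0r.
  suff -> : \sum_i (p * 'X + c%:P).[lam i] *: v i =
      c *: (\sum_i v i) + T (\sum_i p.[lam i] *: v i) by apply/Wlin/WT.
  rewrite scaler_sumr -[T _]/(T' _) linear_sum -big_split;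
    apply: eq_bigr => i _.
  by rewrite linearZ /= Tv hornerMXaddC scalerDl scalerA addrC.
pose p : {poly C} := \prod_(i | i != k) ('X - (lam i)%:P).
have pE i : p.[lam i] = \prod_(j | j != k) (lam i - lam j).
  by rewrite horner_prod; apply: eq_bigr => j _; rewrite hornerXsubC.
have pk : p.[lam k] != 0.
  rewrite pE; apply/prodf_neq0 => j jk; rewrite subr_eq0.
  by apply: contra jk => /eqP/lam_inj ->.
have := Wlin (p.[lam k])^-1 _ 0 (Wp p) W0.
rewrite (bigD1 k)//= big1 => [|i ik]; last first.
  by rewrite pE (bigD1 i)//= subrr mul0r scale0r.
by rewrite !addr0 scalerA mulVf// scale1r.
Qed.

Lemma linear_subspaceZ (V : lmodType C) (W : set V) c v :
  linear_subspace W -> W v -> W (c *: v).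
Proof. by move=> [W0 Wlin] Wv; rewrite -[_ *: _]addr0; exact: Wlin. Qed.

Lemma linear_subspace_sum (V : lmodType C) (W : set V) (I : finType) (v : I ->
  V) :
  linear_subspace W -> (forall i, W (v i)) -> W (\sum_i v i).
Proof.
move=> [W0 Wlin] Wv; apply: big_ind => // x y Wx Wy.
by rewrite -[x]scale1r; exact: Wlin.
Qed.

(** A torus element with distinct weights in the first factor isolates row [k], one in the second
    factor isolates column [l]; what remains is [X k l] times the matrix unit. *)
Lemma boxtimes_delta m1 m2 (W : set 'M[C]_(m1.+1, m2.+1)) X k l :
  linear_subspace W -> act_invariant (@boxtimes_act R m1 m2) W ->
  W X -> X k l != 0 -> W (delta_mx k l).
Proof.
move=> Wsub Winv WX Xkl.
have [x1 inj1] := torus_weights_inj m1; have [x2 inj2] := torus_weights_inj m2.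
have WY : W (delta_mx k k *m X).
  apply: (eigen_component (T := mulmx (Vrep m1 (torus_mx x1)))
    (v := fun i => delta_mx i i *m X) (linearP _) inj1) => //.
  - move=> i; rewrite mulmxA Vrep_torus scalemxAl; congr (_ *m _).
    apply/matrixP => a b; rewrite mul_diag_mx !mxE.
    by have [->|] := eqVneq a i; rewrite //= !mulr0.
  - move=> Y WY; have := Winv _ _ (SU2_torus x1) SU2_1 _ WY.
    by rewrite /boxtimes_act Vrep1 trmx1 mulmx1.
  - rewrite -mulmx_suml (_ : \sum_i _ = 1%:M) ?mul1mx//.
    by rewrite mx1_sum_delta.
have WZ : W (delta_mx k k *m X *m delta_mx l l).
  apply: (eigen_component (T := mulmxr (Vrep m2 (torus_mx x2)))
    (v := fun i => delta_mx k k *m X *m delta_mx i i) (linearP _) inj2) => //.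
  - move=> i; rewrite /= -mulmxA Vrep_torus scalemxAr; congr (_ *m _).
    apply/matrixP => a b; rewrite mul_mx_diag !mxE.
    by have [->|] := eqVneq b i; rewrite ?andbT ?andbF ?mul0r ?mulr0// mulrC.
  - move=> Y WY'; have := Winv _ _ SU2_1 (SU2_torus x2) _ WY'.
    by rewrite /boxtimes_act Vrep1 mul1mx /= Vrep_torus tr_diag_mx.
  - rewrite -mulmx_sumr (_ : \sum_i _ = 1%:M) ?mulmx1//.
    by rewrite mx1_sum_delta.
have -> : delta_mx k l = (X k l)^-1 *: (delta_mx k k *m X *m delta_mx l l).
  apply/matrixP => i j; rewrite !mxE (bigD1 l)//= big1 => [|a al]; last first.
    by rewrite !mxE (negbTE al) mulr0.
  rewrite !mxE (bigD1 k)//= big1 => [|a ak]; last first.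
    by rewrite !mxE (negbTE ak) andbF mul0r.
  by rewrite !mxE !eqxx andbT !addr0; case: eqP; case: eqP;
    rewrite /= ?mul0r ?mulr0// mul1r mulr1 mulVf.
exact: linear_subspaceZ.
Qed.

Lemma boxtimes_irreducible m1 m2 (W : set 'M[C]_(m1.+1, m2.+1)) :
  linear_subspace W -> act_invariant (@boxtimes_act R m1 m2) W ->
  W = [set 0] \/ W = setT.
Proof.
move=> Wsub Winv; have [W0|/existsNP[X /not_implyP[WX /eqP X0]]] :=
    pselect (forall X, W X -> X = 0).
  left; apply/seteqP; split => [X /W0->//|X ->]; exact: Wsub.1.
right; apply/seteqP; split => // Y _.
have [k [l Xkl]] : exists k l, X k l != 0.
  apply: contrapT => /forallNP h; case/eqP: X0; apply/matrixP => k l.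
  by have /forallNP/(_ l)/negP := h k; rewrite negbK mxE => /eqP.
have Wkl := boxtimes_delta Wsub Winv WX Xkl.
have rotE i j a b :
    boxtimes_act rotation345 rotation345 (delta_mx i j) a b =
    Vrep m1 rotation345 a i * Vrep m2 rotation345 b j.
  rewrite /boxtimes_act !mxE (bigD1 j)//= big1 => [|c cj]; last first.
    rewrite !mxE big1 ?mul0r// => e _.
    by rewrite !mxE (negbTE cj) andbF mulr0.
  rewrite !mxE (bigD1 i)//= big1 => [|c ci]; last first.
    by rewrite !mxE (negbTE ci) mulr0.
  by rewrite !mxE !eqxx mulr1 !addr0.
have Wrot i j : W (delta_mx i j) ->
    W (boxtimes_act rotation345 rotation345 (delta_mx i j)).
  by apply: Winv; exact: SU2_rotation345.
(* The corner serves as a relay: the last row of the rotated representation leads from any unit to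
   it, the last column from it to any unit, and these are the entries known to be nonzero. *)
have Wmax : W (delta_mx ord_max ord_max).
  apply: (boxtimes_delta Wsub Winv (Wrot _ _ Wkl)).
  by rewrite rotE mulf_neq0// Vrep_rotation_row.
have Wall i j : W (delta_mx i j).
  apply: (boxtimes_delta Wsub Winv (Wrot _ _ Wmax)).
  by rewrite rotE mulf_neq0// Vrep_rotation_col.
rewrite (matrix_sum_delta Y); apply: linear_subspace_sum => // i.
by apply: linear_subspace_sum => // j; exact: linear_subspaceZ.
Qed.

End Irreducibility.

(** * From a transformation rule of a family to an irreducible representation *)

Section Realization.
Variable R : realType.
Local Notation C := R[i].
Variables (V : lmodType C) (act : 'M[C]_2 -> 'M[C]_2 -> V -> V).
Hypothesis act_linear : forall a d, linear (act a d).

Definition combination m1 m2 (g : 'I_m1 -> 'I_m2 -> V) (X : 'M[C]_(m1, m2)) : V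
  :=
  \sum_j \sum_k X j k *: g j k.

Lemma combination_is_linear m1 m2 (g : 'I_m1 -> 'I_m2 -> V) :
  linear (combination g).
Proof.
move=> c X Y; rewrite /combination scaler_sumr -big_split;
  apply: eq_bigr => j _.
rewrite scaler_sumr -big_split; apply: eq_bigr => k _.
by rewrite !mxE scalerDl scalerA.
Qed.

HB.instance Definition _ m1 m2 (g : 'I_m1 -> 'I_m2 -> V) :=
  GRing.isLinear.Build C 'M[C]_(m1, m2) V _ (combination g)
    (combination_is_linear g).

Lemma combination_delta m1 m2 (g : 'I_m1 -> 'I_m2 -> V) j k :
  combination g (delta_mx j k) = g j k.
Proof.
rewrite /combination (bigD1 j)//= (bigD1 k)//= mxE !eqxx scale1r.
rewrite big1 => [|k' kk]; last by rewrite mxE (negbTE kk) andbF scale0r.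
rewrite big1 => [|j' jj]; first by rewrite !addr0.
by rewrite big1// => k' _; rewrite mxE (negbTE jj) scale0r.
Qed.

Lemma act_combination m1 m2 (g : 'I_m1 -> 'I_m2 -> V) (a d : 'M[C]_2)
    (A : 'M[C]_m1) (B : 'M[C]_m2) :
  (forall j k, act a d (g j k) =
     \sum_j' \sum_k' (A j j' * B k k') *: g j' k') ->
  forall X, act a d (combination g X) = combination g (A^T *m X *m B).
Proof.
move=> actg X.
pose T : {linear V -> V} :=
  HB.pack (act a d) (GRing.isLinear.Build _ _ _ _ (act a d) (act_linear a d)).
rewrite -[act a d _]/(T _) /combination linear_sum.
transitivity (\sum_j \sum_k \sum_j' \sum_k' (X j k * (A j j' * B k k')) *: g j'
  k').
  apply: eq_bigr => j _; rewrite linear_sum; apply: eq_bigr => k _.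
  rewrite linearZ /= actg scaler_sumr; apply: eq_bigr => j' _.
  by rewrite scaler_sumr; apply: eq_bigr => k' _; rewrite scalerA.
under eq_bigr => j _ do rewrite exchange_big /=.
rewrite exchange_big /=; apply: eq_bigr => j' _.
under eq_bigr => j _ do rewrite exchange_big /=.
rewrite exchange_big /=; apply: eq_bigr => k' _.
rewrite exchange_big /= mxE scaler_suml; apply: eq_bigr => k _.
rewrite mxE mulr_suml scaler_suml; apply: eq_bigr => j _.
by rewrite mxE mulrA mulrC [X j k * _]mulrC mulrC.
Qed.

Definition realizes m1 m2 (U : set V) :=
  [/\ act_invariant act U, irreducible_rep act U & iso_boxtimes act m1 m2 U].

(** Coefficient matrices transform by X -> A^T X B, and [P], [Q] turn this into the external tensor
    product. Linear independence of the [g j k] is a consequence: the kernel is invariant and, as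
    one [g j k] is nonzero, not everything. *)
Lemma realizes_combination m1 m2 (g : 'I_m1.+1 -> 'I_m2.+1 -> V)
    (A : 'M[C]_2 -> 'M[C]_m1.+1) (B : 'M[C]_2 -> 'M[C]_m2.+1)
    (P : 'M[C]_m1.+1) (Q : 'M[C]_m2.+1) :
  (forall a d, SU2 a -> SU2 d -> forall j k, act a d (g j k) =
     \sum_j' \sum_k' (A a j j' * B d k k') *: g j' k') ->
  P \in unitmx -> Q \in unitmx ->
  (forall a, SU2 a -> (A a)^T *m P = P *m Vrep m1 a) ->
  (forall d, SU2 d -> (B d)^T *m Q = Q *m Vrep m2 d) ->
  (exists j k, g j k != 0) ->
  realizes m1 m2 (range (combination g)).
Proof.
move=> actg Pu Qu AP BQ [j0 [k0 g0]].
pose phi : {linear 'M[C]_(m1.+1, m2.+1) -> V} :=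
  combination g \o (mulmxr Q^T \o mulmx P).
have actphi a d : SU2 a -> SU2 d -> forall X,
    phi (boxtimes_act a d X) = act a d (phi X).
  move=> sa sd X; rewrite /phi /= (act_combination (actg _ _ sa sd)).
  congr (combination g _); rewrite /boxtimes_act !mulmxA AP// -!mulmxA.
  by congr (_ *m (_ *m (_ *m _))); rewrite -trmx_mul -BQ// trmx_mul trmxK.
have phi_range : range phi = range (combination g).
  apply/seteqP; split => _ [X _ <-]; first by exists (P *m X *m Q^T).
  exists (invmx P *m X *m invmx Q^T) => //.
  rewrite /phi /= !mulmxA mulmxV// mul1mx mulmxKV//.
  by rewrite unitmx_tr.
clearbody phi.
(* Pulling back along [phi] serves twice: for the kernel, and for an arbitrary invariant subspace of
   the range. *)
have preim_sub (W : set V) : linear_subspace W ->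
    linear_subspace [set X | W (phi X)].
  move=> [W0 Wlin]; split => [|c X Y WX WY] /=; first by rewrite linear0.
  by rewrite linearP; exact: Wlin.
have preim_inv (W : set V) : act_invariant act W ->
    act_invariant (@boxtimes_act R m1 m2) [set X | W (phi X)].
  by move=> Winv a d sa sd X /= WX; rewrite actphi//; exact: Winv.
have act0 a d : act a d 0 = 0.
  pose T : {linear V -> V} :=
    HB.pack (act a d) (GRing.isLinear.Build _ _ _ _ (act a d) (act_linear a d)).
  exact: (linear0 T).
have phi_inj : injective phi.
  have [ker0|kerT] : [set X | [set 0 : V] (phi X)] = [set 0] \/
      [set X | [set 0 : V] (phi X)] = setT.
    apply: boxtimes_irreducible; [apply: preim_sub|apply: preim_inv].
      by split => // c _ _ -> ->; rewrite scaler0 addr0.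
    by move=> a d _ _ _ ->; exact: act0.
  - move=> X Y XY; apply/eqP; rewrite -subr_eq0; apply/eqP.
    have : [set X | [set 0 : V] (phi X)] (X - Y) by rewrite /= linearB /= XY
      subrr.
    by rewrite ker0.
  - have [X _ Xg] : range phi (g j0 k0).
      by rewrite phi_range; exists (delta_mx j0 k0) => //;
        exact: combination_delta.
    have : [set X | [set 0 : V] (phi X)] X by rewrite kerT.
    by rewrite /= Xg => g00; rewrite g00 eqxx in g0.
have U_inv : act_invariant act (range (combination g)).
  by rewrite -phi_range => a d sa sd _ [X _ <-]; rewrite -actphi.
split => //; last by exists phi.
split => //.
- rewrite -phi_range; split; first by exists 0; rewrite ?linear0.
  by move=> c _ _ [X _ <-] [Y _ <-]; exists (c *: X + Y); rewrite ?linearP.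
- apply/eqP => /seteqP[U0 _]; move/eqP: g0; apply; apply: U0.
  by exists (delta_mx j0 k0) => //; exact: combination_delta.
- move=> W Wsub Winv WU.
  have [W0|WT] := boxtimes_irreducible (preim_sub _ Wsub) (preim_inv _ Winv).
  + left; apply/seteqP; split => [w Ww|_ ->]; last exact: Wsub.1.
    have := WU _ Ww; rewrite -phi_range => -[X _ Xw].
    have : [set X | W (phi X)] X by rewrite /= Xw.
    by rewrite W0 => X0; rewrite -Xw X0 /= linear0.
  + right; apply/seteqP; split => //; rewrite -phi_range => _ [X _ <-].
    by have : [set X | W (phi X)] X by rewrite WT.
Qed.

End Realization.

(** * Separation of the homogeneous degrees in the span of a family *)

Section HomogeneousParts.
Variable R : realType.
Local Notation C := R[i].
Variables (n : nat) (F : nat -> nat -> nat -> 'M[C]_2 -> tens R n).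
Variable deg : nat -> int.
Hypothesis deg_inj : injective deg.
Hypothesis F_homogeneous : forall m i j, (i <= m)%N -> (j <= m + n)%N ->
  forall (c : C) (Z : 'M[C]_2), c != 0 -> F m i j (c *: Z) = c ^ deg m *: F m i
    j Z.

Definition family_component (m : nat) : set ('M[C]_2 -> tens R n) :=
  range (combination (fun (i : 'I_m.+1) (j : 'I_(m + n).+1) => F m i j)).

Lemma family_component_sub m : linear_subspace (family_component m).
Proof.
split; first by exists 0; rewrite ?linear0.
by move=> c _ _ [X _ <-] [Y _ <-]; exists (c *: X + Y); rewrite ?linearP.
Qed.

Lemma scalerCA (V : lmodType C) (a b : C) (v : V) :
  a *: (b *: v) = b *: (a *: v).
Proof. by rewrite !scalerA mulrC. Qed.

Lemma family_component_homogeneous m f (c : C) (Z : 'M[C]_2) :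
  family_component m f -> c != 0 -> f (c *: Z) = c ^ deg m *: f Z.
Proof.
move=> [X _ <-] c0; rewrite /combination !fct_sumE scaler_sumr.
apply: eq_bigr => i _; rewrite !fct_sumE scaler_sumr; apply: eq_bigr => j _.
have im : (i <= m)%N by rewrite -ltnS.
have jm : (j <= m + n)%N by rewrite -ltnS.
change (X i j *: F m i j (c *: Z) = c ^ deg m *: (X i j *: F m i j Z)).
by rewrite (F_homogeneous im jm Z c0); exact: scalerCA.
Qed.

Lemma family_span_sub : linear_subspace (family_span F).
Proof.
split.
  by exists 0%N, (fun=> 0), (fun=> 0); split => [[]//|]; rewrite big_ord0.
move=> c _ _ [k1 [c1 [g1 [Ag1 ->]]]] [k2 [c2 [g2 [Ag2 ->]]]].
exists (k1 + k2)%N, (fun i => match fintype.split i with inl a => c * c1 a | inr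
  b => c2 b end),
  (fun i => match fintype.split i with inl a => g1 a | inr b => g2 b end);
    split.
  by move=> i; case: fintype.split.
rewrite big_split_ord /= scaler_sumr; congr (_ + _); apply: eq_bigr => i _.
  by rewrite (unsplitK (inl i)) scalerA.
by rewrite (unsplitK (inr i)).
Qed.

Lemma family_component_span m : family_component m `<=` family_span F.
Proof.
move=> _ [X _ <-]; apply: (linear_subspace_sum family_span_sub) => i.
apply: (linear_subspace_sum family_span_sub) => j.
apply: (linear_subspaceZ _ family_span_sub).
exists 1%N, (fun=> 1), (fun=> F m i j); split => [_|].
  by exists m, i, j; split; rewrite // -ltnS.
by rewrite big_ord1 scale1r.
Qed.

(** Allowing every [N] from [M] on supports the induction: a further generator may have a larger [m]
    and force a longer sum. *)
Lemma family_span_components f : family_span F f ->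
  exists M (f_ : nat -> 'M[C]_2 -> tens R n),
    (forall m, family_component m (f_ m)) /\
    forall N, (M <= N)%N -> f = \sum_(m < N) f_ m.
Proof.
move=> [k [c [g [Ag ->]]]]; elim: k c g Ag => [|k IH] c g Ag.
  exists 0%N, (fun=> 0); split => [m|N _]; first exact: (family_component_sub
    m).1.
  by rewrite big_ord0 big1.
have [M [f_ [Uf fE]]] := IH (fun i => c (widen_ord (leqnSn k) i))
  (fun i => g (widen_ord (leqnSn k) i)) (fun i => Ag _).
have [m [i [j [im jm gE]]]] := Ag ord_max.
exists (maxn M m.+1), (fun m' => c ord_max *: (if m' == m then g ord_max else 0)
  + f_ m').
split => [m'|N MN].
  apply: (family_component_sub m').2; last exact: Uf.
  have [->|_] := eqVneq m' m; last exact: (family_component_sub m').1.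
  rewrite gE; exists (delta_mx (inord i) (inord j)) => //.
  by rewrite combination_delta !inordK.
rewrite big_ord_recr /= big_split /= -fE; last exact: leq_trans (leq_maxl _ _)
  MN.
rewrite addrC; congr (_ + _).
have mN : (m < N)%N by exact: leq_trans (leq_maxr _ _) MN.
rewrite -scaler_sumr; congr (_ *: _).
rewrite (bigD1 (Ordinal mN))//= eqxx big1 ?addr0// => l lm.
by case: eqP => // e; move/eqP: lm; case; exact/val_inj.
Qed.


Definition dilate (f : 'M[C]_2 -> tens R n) : 'M[C]_2 -> tens R n :=
  fun Z => f (2 *: Z).

(** The powers are compared in the reals, where integer powers of 2 are strictly monotone in the
    exponent. *)
Lemma exprz2_inj : injective (fun d : int => (2 : C) ^ d).
Proof.
have h (d : int) : (2 : C) ^ d = ((2 : R) ^ d)%:C%C.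
  have u2 : (2 : R) \is a GRing.unit by rewrite unitfE pnatr_eq0.
  by rewrite (rmorphXz (real_complex R) d u2) rmorph_nat.
move=> a b /=; rewrite !h => /complexI; apply: ieexprIz; first exact: ltr0n.
by rewrite -[1]/(1%:R) eqr_nat.
Qed.

(* Dilation by 2 separates the degrees: in a homogeneous sum, each component is
   a multiple of the sum. *)
Lemma homogeneous_part_components f d : homogeneous_part (family_span F) d f ->
  exists M (f_ : nat -> 'M[C]_2 -> tens R n),
    [/\ forall m, family_component m (f_ m), f = \sum_(m < M) f_ m &
        forall m : 'I_M, deg m != d -> f_ m = 0].
Proof.
move=> [/family_span_components[M [f_ [Uf fE]]] fhom].
exists M, f_; split => [//| |m dm]; first exact: fE.
have n2 : (2 : C) != 0 by rewrite pnatr_eq0.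
have [c fc] : exists c : C, f_ m = c *: f.
  (* The invariant subspace is the line through [f], stable under dilation because [f] is
     homogeneous. *)
  apply: (@eigen_component R _ [set g | exists c : C, g = c *: f] dilate M
    (fun m => 2 ^ deg m) f_).
  - by move=> c g h; apply/funext => Z.
  - by move=> a b /exprz2_inj/deg_inj/val_inj.
  - by move=> k; apply/funext => Z; rewrite /dilate
    (family_component_homogeneous _ (Uf k)).
  - split; first by exists 0; rewrite scale0r.
    by move=> c _ _ [x ->] [y ->]; exists (c * x + y); rewrite scalerDl scalerA.
  - move=> _ [x ->]; exists (2 ^ d * x); apply/funext => Z.
    change (x *: f (2 *: Z) = (2 ^ d * x) *: f Z).
    by rewrite (fhom 2 Z n2) scalerA mulrC.
  - by exists 1; rewrite scale1r -fE.
(* Being a multiple of [f], the component scales with degree [d] as well as with [deg m]. *)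
have : (2 ^ deg m - 2 ^ d) *: f_ m = 0.
  apply/funext => Z; rewrite scalerBl; apply/eqP; rewrite subr_eq0; apply/eqP.
  rewrite -[LHS](family_component_homogeneous _ (Uf m))// fc.
  change (c *: f (2 *: Z) = 2 ^ d *: (c *: f Z)).
  by rewrite (fhom 2 Z n2); exact: scalerCA.
move/eqP; rewrite scaler_eq0 subr_eq0 => /orP[/eqP/exprz2_inj e|/eqP//].
by rewrite e eqxx in dm.
Qed.

Lemma homogeneous_part_component m :
  homogeneous_part (family_span F) (deg m) = family_component m.
Proof.
apply/seteqP; split => f.
  move=> /homogeneous_part_components[M [f_ [Uf -> f0]]].
  apply: (linear_subspace_sum (family_component_sub m)) => k.
  have [<-//|km] := eqVneq (k : nat) m.
  by rewrite f0 ?(inj_eq deg_inj)//; exact: (family_component_sub m).1.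
move=> Uf; split; first exact: family_component_span Uf.
by move=> c Z c0; exact: family_component_homogeneous.
Qed.

Lemma homogeneous_part0 d : (forall m, deg m != d) ->
  homogeneous_part (family_span F) d = [set 0].
Proof.
move=> dd; apply/seteqP; split => f.
  by move=> /homogeneous_part_components[M [f_ [_ -> f0]]];
    rewrite /= big1// => m _; exact: f0.
move=> ->; split; first exact: family_span_sub.1.
by move=> c Z _; rewrite scaler0.
Qed.

End HomogeneousParts.

(** * Contour integrals and directional derivatives as polynomial coefficients *)

Section ComplexAnalysis.
Variable R : realType.
Local Notation C := R[i].
Local Open Scope complex_scope.

Lemma trig_2pi_int (z : int) :
  cos (z%:~R * (2 * pi)) = 1 :> R /\ sin (z%:~R * (2 * pi)) = 0 :> R.
Proof.
have pos k : cos (k%:R * (2 * pi)) = 1 :> R /\ sin (k%:R * (2 * pi)) = 0 :> R.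
  have -> : k%:R * (2 * pi) = 0 + (pi *+ 2) *+ k :> R.
    by rewrite add0r -(mulr_natl (pi *+ 2)) -(mulr_natl pi).
  rewrite (periodicn (@cosD2pi R)) (periodicn (@sinD2pi R)).
  by rewrite cos0 sin0.
case: z => k; first exact: pos.
have [c s] := pos k.+1.
by rewrite NegzE mulrNz mulNr cosN sinN c s oppr0.
Qed.

Lemma trig_continuous (a b c : R) :
  continuous (fun x : R => a * cos (c * x) + b * sin (c * x)).
Proof.
move=> x; apply: cvgD; apply: cvgM; try exact: cvg_cst.
- by apply: (@continuous_comp _ _ _ ( *%R c) cos);
  [exact: mulrl_continuous|exact: continuous_cos].
- by apply: (@continuous_comp _ _ _ ( *%R c) sin);
  [exact: mulrl_continuous|exact: continuous_sin].
Qed.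

Lemma Rintegral_trig (a b : R) (z : int) :
  \int[lebesgue_measure]_(x in `[0, 2 * pi])
     (a * cos (z%:~R * x) + b * sin (z%:~R * x)) =
  (if z == 0 then a else 0) * (2 * pi) :> R.
Proof.
have pi2 : 0 < 2 * pi :> R by rewrite mulr_gt0 ?pi_gt0.
have [->|z0] := eqVneq z 0.
  under eq_Rintegral do rewrite mul0r cos0 sin0 mulr1 mulr0 addr0.
  rewrite Rintegral_cst//= lebesgue_measure_itv/= lte_fin pi2 /=.
  by rewrite oppr0 addr0.
rewrite mul0r; have zR : (z%:~R : R) != 0 by rewrite intr_eq0.
pose lin : R -> R := (z%:~R : R) \*: (@idfun R : R -> R).
(* Antiderivative for nonzero frequency; it takes the same value at 0 and at 2 pi. *)
pose F : R -> R := (a / z%:~R) \*: (sin \o lin) - (b / z%:~R) \*: (cos \o lin).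
have dF (x : R) : is_derive x 1 F (a * cos (z%:~R * x) + b * sin (z%:~R * x)).
  have dl : is_derive x 1 lin z%:~R.
    by apply: is_derive_eq; rewrite /GRing.scale /= mulr1.
  have ds : is_derive x 1 (sin \o lin) (cos (z%:~R * x) * z%:~R).
    exact: is_derive1_comp.
  have dc : is_derive x 1 (cos \o lin) (- sin (z%:~R * x) * z%:~R).
    exact: is_derive1_comp.
  by apply: is_derive_eq; rewrite /GRing.scale /=; field.
have cF : continuous F.
  move=> x; apply: differentiable_continuous; apply/derivable1_diffP.
  exact: ex_derive.
rewrite /Rintegral (@continuous_FTC2 _ _ F)//.
- have [c2 s2] := trig_2pi_int z.
  rewrite -EFinB /= /F /lin !fctE /= /GRing.scale /= c2 s2 !mulr0.
  by rewrite sin0 cos0 mulr0 subrr.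
- by apply: continuous_subspaceT => x; exact: trig_continuous.
- split=> [x _| |]; first exact: ex_derive.
    exact/cvg_at_right_filter/cF.
  exact/cvg_at_left_filter/cF.
- by move=> x _; rewrite derive1E; exact: derive_val.
Qed.

Lemma Rintegral_trig_sum N (a b : nat -> R) (z : nat -> int) :
  \int[lebesgue_measure]_(x in `[0, 2 * pi])
     (\sum_(k < N) (a k * cos ((z k)%:~R * x) + b k * sin ((z k)%:~R * x))) =
  \sum_(k < N) (if z k == 0 then a k else 0) * (2 * pi) :> R.
Proof.
pose S M (x : R) := \sum_(k < M) (a k * cos ((z k)%:~R * x) + b k * sin ((z
  k)%:~R * x)).
have cS M : continuous (S M).
  elim: M => [|M IH] x.
    by rewrite /S; under eq_fun do rewrite big_ord0; exact: cvg_cst.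
  rewrite /S; under eq_fun do rewrite big_ord_recr /=.
  by apply: cvgD; [exact: IH|exact: trig_continuous].
elim: N => [|N IH].
  by under eq_Rintegral do rewrite big_ord0; rewrite big_ord0 Rintegral_cst//
    mul0r.
under eq_Rintegral do rewrite big_ord_recr /=.
rewrite big_ord_recr /= RintegralD//.
- by rewrite IH Rintegral_trig.
- apply: continuous_compact_integrable; first exact: segment_compact.
  by apply: continuous_subspaceT; exact: cS.
- apply: continuous_compact_integrable; first exact: segment_compact.
  by apply: continuous_subspaceT; exact: trig_continuous.
Qed.

(** The factor i s from ds = i s dx cancels 1/s up to i, leaving a trigonometric polynomial with the
    frequencies k - i. *)
Lemma unit_circle_laurent (p : {poly C}) i x :
  p.[unit_circle x] * (unit_circle x) ^- i / unit_circle x *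
    ('i%C * unit_circle x) =
  \sum_(k < size p) ('i%C * p`_k) * unit_circle ((k%:Z - i%:Z)%:~R * x).
Proof.
have u0 : unit_circle x != 0 :> C.
  by apply/eqP => u0; have /eqP := unit_circle_conj x;
    rewrite u0 mul0r eq_sym oner_eq0.
have -> : p.[unit_circle x] * unit_circle x ^- i / unit_circle x *
    ('i%C * unit_circle x) = 'i%C * p.[unit_circle x] * unit_circle x ^- i.
  have ui : unit_circle x ^+ i != 0 :> C by rewrite expf_neq0.
  by field; rewrite u0 ui.
have uVi : unit_circle x ^- i = unit_circle (- (i%:R * x)) :> C.
  apply: (mulfI (expf_neq0 i u0)); rewrite divff ?expf_neq0//.
  by rewrite unit_circleX unit_circle_conj.
rewrite uVi horner_coef -mulrA mulr_suml mulr_sumr; apply: eq_bigr => k _.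
rewrite unit_circleX -!mulrA; congr (_ * (_ * _)).
have -> : (k%:Z - i%:Z)%:~R * x = k%:R * x + - (i%:R * x) by rewrite intrB
  mulrBl.
rewrite /unit_circle cosD sinD; simpc.
by congr (_ +i* _); rewrite addrC.
Qed.

(** The residue theorem for Laurent polynomials: only the term of frequency zero has a nonzero
    integral. *)
Lemma circle_integral_laurent (p : {poly C}) i :
  circle_integral (fun s => p.[s] * s ^- i / s) =
  p`_i * (2 * pi%:C * 'i%C).
Proof.
pose z (k : nat) : int := k%:Z - i%:Z.
pose a k := complex.Re ('i%C * p`_k : C); pose b k := complex.Im ('i%C * p`_k :
  C).
rewrite /circle_integral.
have Eh (x : R) : p.[cos x +i* sin x] * (cos x +i* sin x) ^- i /
    (cos x +i* sin x) * ('i%C * (cos x +i* sin x)) =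
    (\sum_(k < size p) (a k * cos ((z k)%:~R * x) + (- b k) * sin ((z k)%:~R *
      x))) +i*
    (\sum_(k < size p) (b k * cos ((z k)%:~R * x) + a k * sin ((z k)%:~R * x)))
      :> C.
  rewrite [LHS](unit_circle_laurent p i x).
  rewrite (eq_bigr (fun k : 'I_(size p) =>
    (a k * cos ((z k)%:~R * x) + (- b k) * sin ((z k)%:~R * x)) +i*
    (b k * cos ((z k)%:~R * x) + a k * sin ((z k)%:~R * x)))); last first.
    move=> k _; rewrite /a /b; case: ('i%C * p`_k) => u v.
    by rewrite /unit_circle -/(z k); simpc; congr (_ +i* _); rewrite addrC.
  elim: (size p) => [|N IH]; first by rewrite !big_ord0.
  by rewrite !big_ord_recr /= IH; simpc.
under eq_Rintegral do rewrite Eh /=.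
rewrite (Rintegral_trig_sum (size p) a (fun k => - b k) z).
under eq_Rintegral do rewrite Eh /=.
rewrite (Rintegral_trig_sum (size p) b a z) -!mulr_suml.
(* For [i] at least [size p] the sum contains no term of frequency zero, and the coefficient is zero
   by default. *)
have sumE (c : nat -> R) : (forall k, (size p <= k)%N -> c k = 0) ->
    \sum_(k < size p) (if z k == 0 then c k else 0) = c i.
  move=> c0; have zE k : (z k == 0) = (k == i) by rewrite /z subr_eq0 eqz_nat.
  have [ip|pi] := ltnP i (size p).
    rewrite (bigD1 (Ordinal ip))//= zE eqxx big1 ?addr0// => k /eqP ki.
    by rewrite zE; case: eqP => // e; case: ki; exact/val_inj.
  rewrite c0// big1// => k _; rewrite zE; case: eqP => // e.
  by move: (ltn_ord k); rewrite e ltnNge pi.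
rewrite !sumE; last 2 first.
- by move=> k sk; rewrite /b nth_default// mulr0.
- by move=> k sk; rewrite /a nth_default// mulr0.
rewrite /a /b; case: (p`_i) => u v; simpc.
by congr (_ +i* _); ring.
Qed.

Lemma tcoefE m i j (Z : 'M[C]_2) : tcoef m i j Z =
  (((Z 0 0 *: 'X + (Z 1 0)%:P) ^+ j *
    (Z 0 1 *: 'X + (Z 1 1)%:P) ^+ (m - j)) : {poly C})`_i.
Proof.
rewrite /tcoef; set p : {poly C} := (_ * _ : {poly C}).
have -> : (fun s => (s * Z 0 0 + Z 1 0) ^+ j * (s * Z 0 1 + Z 1 1) ^+ (m - j) *
    s ^- i / s) = (fun s => p.[s] * s ^- i / s).
  by apply/funext => s; rewrite /p !hornerE ![s * _]mulrC.
rewrite circle_integral_laurent mulrC mulfK//.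
rewrite !mulf_neq0 ?pnatr_eq0 ?neq0Ci//.
by rewrite fmorph_eq0 gt_eqF// pi_gt0.
Qed.

Lemma horner_continuous (K : numFieldType) (p : {poly K}) :
  continuous (horner p).
Proof.
move=> x; elim/poly_ind: p => [|p c IH].
  rewrite (_ : horner 0 = cst 0); first exact: cst_continuous.
  by apply/funext => y; rewrite horner0.
rewrite (_ : horner _ = fun y => p.[y] * y + c); last first.
  by apply/funext => y; rewrite hornerMXaddC.
by apply: (cvgD (cvgM IH (@cvg_id _ (nbhs x))) (cvg_cst c)).
Qed.

(** Writing p = q X + c, the difference quotient at h is exactly q(h), which tends to q(0).
    Differentiation thereby becomes extraction of a coefficient. *)
Lemma derive_polynomial (K : numFieldType) (V : normedModType K) (f : V -> K^o)
    (v Z : V) (p : {poly K}) :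
  (forall h : K, f (h *: v + Z) = p.[h]) -> 'D_v f Z = p`_1.
Proof.
have [q [c ->]] : exists q c, p = q * 'X + c%:P.
  elim/poly_ind: p => [|q c _]; last by exists q, c.
  by exists 0, 0; rewrite mul0r addr0.
move=> fp; rewrite coefD coefMX coefC addr0 /= -horner_coef0.
apply: cvg_lim => //.
have fZ : f Z = c by have := fp 0; rewrite scale0r add0r hornerMXaddC mulr0
  add0r.
have cq : q.[h] @[h --> (0 : K)^'] --> q.[0].
  by apply: cvg_within_filter; exact: horner_continuous.
apply: cvg_trans cq.
apply: near_eq_cvg; near=> h.
have h0 : h != 0 by near: h; exact: nbhs_dnbhs_neq.
by rewrite /= fp fZ hornerMXaddC addrK /GRing.scale /= mulrC mulfK.
Unshelve. all: by end_near.
Qed.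

(** Binomial expansion in [h]. For [a = 0] the multiplicity [*+ a] makes the truncated [a.-1]
    harmless. *)
Lemma coef_exprD_poly (p q l e : {poly C}) a i :
  exists P : {poly C},
    (forall h : C, (p * (h *: e + l) ^+ a * q)`_i = P.[h]) /\
    P`_1 = (p * (e * l ^+ a.-1 *+ a) * q)`_i.
Proof.
pose P : {poly C} := \poly_(k < a.+1) (p * ((l ^+ (a - k) * e ^+ k) *+ 'C(a, k))
  * q)`_i.
exists P; split => [h|].
  rewrite horner_poly addrC exprDn mulr_sumr mulr_suml coef_sum.
  apply: eq_bigr => k _; rewrite exprZn -scalerAr scalerMnr -scalerAr -scalerAl
    coefZ.
  by rewrite mulrC.
rewrite coef_poly; clear P; case: a => [|a] /=;
  first by rewrite mulr0n mulr0 mul0r coef0.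
by rewrite bin1 subSS subn0 expr1 [e * _]mulrC.
Qed.

End ComplexAnalysis.

(** * The four families as entries of matrix products *)

Section Families.
Variables (R : realType) (n : nat).
Local Notation C := R[i].
Implicit Types (I J : n.-tuple 'I_2).

Definition column_form (k : 'I_2) (Z : 'M[C]_2) : {poly C} :=
  Z 0 k *: 'X + (Z 1 k)%:P.

(** The derivative of a column form in its entry of row [r]. *)
Definition row_form (r : 'I_2) : {poly C} := if r == 0 then 'X else 1.

Lemma column_formD (h : C) r k k' (Z : 'M[C]_2) :
  column_form k' (h *: delta_mx r k + Z) =
  (if k == k' then h *: row_form r else 0) + column_form k' Z.
Proof.
rewrite /column_form !mxE !scalerDl !polyCD addrACA; congr (_ + _).
rewrite [k' == k]eq_sym; have [_|_] := eqVneq k k'; last first.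
  by rewrite !andbF !mulr0 scale0r add0r.
case: (ord2P r) => ->; rewrite /row_form /= ?mulr1 ?mulr0.
  by rewrite polyC0 addr0.
by rewrite scale0r add0r alg_polyC.
Qed.

(** The prefactor [p] collects what earlier derivatives have produced, so that the rule can be
    iterated. *)
Lemma partial_column0 r (p : {poly C}) a b i :
  partial r 0 (fun Z => (p * column_form 0 Z ^+ a * column_form 1 Z ^+ b)`_i) =
  (fun Z => ((p * row_form r *+ a) * column_form 0 Z ^+ a.-1 * column_form 1 Z
    ^+ b)`_i).
Proof.
apply/funext => Z; rewrite /partial.
have [P [PE P1]] := coef_exprD_poly p (column_form 1 Z ^+ b) (column_form 0 Z)
  (row_form r) a i.
rewrite (derive_polynomial (p := P)) ?P1; last first.
  by move=> h; rewrite -PE !column_formD /= add0r.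
by congr (_`_i); rewrite mulrnAr mulrnAl -!mulrnAl !mulrA.
Qed.

Lemma partial_column1 r (p : {poly C}) a b i :
  partial r 1 (fun Z => (p * column_form 0 Z ^+ a * column_form 1 Z ^+ b)`_i) =
  (fun Z => ((p * row_form r *+ b) * column_form 0 Z ^+ a * column_form 1 Z ^+
    b.-1)`_i).
Proof.
apply/funext => Z; rewrite /partial.
have [P [PE P1]] := coef_exprD_poly p (column_form 0 Z ^+ a) (column_form 1 Z)
  (row_form r) b i.
rewrite (derive_polynomial (p := P)) ?P1; last first.
  by move=> h; rewrite -PE !column_formD /= add0r mulrAC.
by congr (_`_i); rewrite mulrnAr mulrnAl -!mulrnAl !mulrA mulrAC.
Qed.

(** Each derivative contributes a factor X, and its index decides which exponent drops. The falling
    factorials vanish when there are too many derivatives, where the truncated exponents would be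
    wrong. *)
Lemma foldr_partial_row a b i (s : seq 'I_2) :
  foldr (fun k => partial 0 k)
    (fun Z : 'M[C]_2 => (column_form 0 Z ^+ a * column_form 1 Z ^+ b)`_i) s =
  (fun Z => ('X^(size s) *+ (a ^_ (count_mem 0%R s) * b ^_ (size s - count_mem
    0%R s)) *
     column_form 0 Z ^+ (a - count_mem 0%R s) *
     column_form 1 Z ^+ (b - (size s - count_mem 0%R s)))`_i).
Proof.
elim: s => [|k s IH] /=.
  by apply/funext => Z; rewrite !subn0 !ffactn0 mul1r.
have sc := count_size (pred1 (0%R : 'I_2)) s.
rewrite IH; case: k => -[|[|//]] lk.
  rewrite (_ : Ordinal lk = 0); last exact/val_inj.
  rewrite partial_column0; apply/funext => Z; rewrite /= add1n subSS subnS.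
  by rewrite ffactnSr /row_form /= [_ *+ _ * 'X]mulrnAl -mulrnA -exprSr mulnAC.
rewrite (_ : Ordinal lk = 1); last exact/val_inj.
rewrite partial_column1; apply/funext => Z; rewrite /= add0n subSn// [in
  RHS]subnS.
by rewrite ffactnSr /row_form /= [_ *+ _ * 'X]mulrnAl -mulrnA -exprSr mulnA.
Qed.

(** Here every derivative lowers the first exponent, and only an index 0 contributes a factor X. *)
Lemma foldr_partial_column a b i (s : seq 'I_2) :
  foldr (fun k => partial k 0)
    (fun Z : 'M[C]_2 => (column_form 0 Z ^+ a * column_form 1 Z ^+ b)`_i) s =
  (fun Z => ('X^(count_mem 0%R s) *+ (a ^_ (size s)) *
     column_form 0 Z ^+ (a - size s) * column_form 1 Z ^+ b)`_i).
Proof.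
elim: s => [|k s IH] /=.
  by apply/funext => Z; rewrite subn0 ffactn0 mul1r.
rewrite IH partial_column0; apply/funext => Z; rewrite subnS ffactnSr.
suff -> : 'X^(count_mem 0%R s) *+ a ^_ (size s) * row_form k =
    'X^((k == 0) + count_mem 0%R s) *+ a ^_ (size s) by rewrite -mulrnA.
rewrite mulrnAl; congr (_ *+ _); case: k => -[|[|//]] lk.
  rewrite (_ : Ordinal lk = 0); last exact/val_inj.
  by rewrite /row_form /= -exprSr.
rewrite (_ : Ordinal lk = 1); last exact/val_inj.
by rewrite /row_form /= mulr1.
Qed.

Lemma tcoef_column_form m i j :
  tcoef m i j = (fun Z : 'M[C]_2 => (column_form 0 Z ^+ j * column_form 1 Z ^+
    (m - j))`_i).
Proof. by apply/funext => Z; rewrite tcoefE. Qed.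

Lemma tcoef_Vrep m (i j : 'I_m.+1) (Z : 'M[C]_2) : tcoef m i j Z = Vrep m Z i j.
Proof. by rewrite tcoefE mxE. Qed.

Definition entry_fun r s (K : 'M[C]_2 -> n.-tuple 'I_2 -> 'M[C]_(r, s)) i j :
    'M[C]_2 -> tens R n :=
  fun Z => [ffun I => K Z I i j].

Lemma fact_ffact a k : (k <= a)%N -> (a ^_ k)%:R = a`!%:R / (a - k)`!%:R :> C.
Proof.
move=> ka; rewrite -(ffact_fact ka) natrM mulfK//.
Qed.

(** The factor X^n from the derivatives undoes the shift by [n] in [i + n]; the falling factorials
    are the entries of [deriv_mx]. *)
Lemma Fplus_entry m (i : 'I_m.+1) (j : 'I_(m + n).+1) :
  Fplus_fun n m i j = entry_fun (fun Z I => Vrep m Z *m deriv_mx R m I) i j.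
Proof.
apply/funext => Z; apply/ffunP => I; rewrite !ffunE.
rewrite tcoef_column_form foldr_partial_row size_tuple.
have pn := count0_le I; set p := count_mem 0%R I in pn *.
have jm : (j <= m + n)%N by rewrite -ltnS.
rewrite -mulrA mulrnAl coefMn coefXnM ltnNge leq_addl /= addnK mxE.
(* If [j < p], or later [m + n - j < n - p], a falling factorial vanishes on the left, and on the
   right no [k] satisfies [j = k + p]. *)
have [pj|jp] := leqP p j; last first.
  rewrite ffact_small// mul0n mulr0n big1// => k _.
  rewrite deriv_mxE -/p; case: eqP => [e|]; last by rewrite mul0r mulr0.
  by rewrite e ltnNge leq_addl in jp.
have [qj|jq] := leqP (n - p) (m + n - j); last first.
  rewrite [X in (_ * X)%N]ffact_small// muln0 mulr0n big1// => k _.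
  rewrite deriv_mxE -/p; case: eqP => [e|]; last by rewrite mul0r mulr0.
  by have := ltn_ord k; lia.
have ltk : (j - p < m.+1)%N by lia.
rewrite (bigD1 (Ordinal ltk))//= big1 ?addr0 => [|k /eqP kj]; last first.
  rewrite deriv_mxE -/p; case: eqP => [e|]; last by rewrite mul0r mulr0.
  by case: kj; apply/val_inj => /=; lia.
rewrite deriv_mxE -/p /= subnK// eqxx mul1r !mxE -[LHS]mulr_natr natrM.
rewrite !fact_ffact//.
have -> : (m + n - j - (n - p) = m - (j - p))%N by lia.
by have -> : (m - (j - p) + (n - p) = m + n - j)%N by lia.
Qed.

Lemma Vrep_entry_poly m (Z : 'M[C]_2) (k : nat) (i : 'I_m.+1) :
  (m < k)%N -> (column_form 0 Z ^+ i * column_form 1 Z ^+ (m - i))`_k = 0.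
Proof.
move=> mk; have im : (i <= m)%N by rewrite -ltnS.
have [sz _] := linear_powers_mul 0 (Z 0 0) (Z 1 0) (Z 0 1) (Z 1 1) i (m - i).
by rewrite nth_default// (leq_trans sz)// subnKC.
Qed.

(** The normalizing quotient of factorials cancels the falling factorial, and X^p acts as the
    shift. *)
Lemma Gplus_entry m (i : 'I_m.+1) (j : 'I_(m + n).+1) :
  Gplus_fun n m i j = entry_fun (fun Z I => shift_mx R m I *m Vrep m Z) j i.
Proof.
apply/funext => Z; apply/ffunP => I; rewrite !ffunE.
rewrite tcoef_column_form foldr_partial_column size_tuple.
have pn := count0_le I; set p := count_mem 0%R I in pn *.
have im : (i <= m)%N by rewrite -ltnS.
rewrite addnK -['X^p *+ _ * _ * _]mulrA ['X^p *+ _ * _]mulrnAl coefMn coefXnM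
  subnDr -[_ *+ _ ^_ _]mulr_natl.
rewrite fact_ffact ?leq_addl// addnK mulrA mulrA mulfVK ?pnatr_eq0 -?lt0n
  ?fact_gt0//.
rewrite divff ?pnatr_eq0 -?lt0n ?fact_gt0// mul1r mxE.
have [jp|pj] := ltnP j p.
  rewrite big1// => k _; rewrite mxE -/p; case: eqP => [e|];
    last by rewrite mul0r.
  by rewrite e ltnNge leq_addl in jp.
have [ltk|ltk] := ltnP (j - p) m.+1; last first.
  rewrite Vrep_entry_poly// big1// => k _.
  rewrite mxE -/p; case: eqP => [e|]; last by rewrite mul0r.
  by have := ltn_ord k; lia.
rewrite (bigD1 (Ordinal ltk))//= big1 ?addr0 => [|k /eqP kj]; last first.
  rewrite mxE -/p; case: eqP => [e|]; last by rewrite mul0r.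
  by case: kj; apply/val_inj => /=; lia.
by rewrite !mxE -/p /= subnK// eqxx mul1r.
Qed.

Lemma Fminus_entry m (i : 'I_m.+1) (j : 'I_(m + n).+1) :
  Fminus_fun n m i j = entry_fun
    (fun Z I => (\det Z)^-1 *: (deriv_mx R m I *m Vrep (m + n) (invmx Z))) i j.
Proof.
apply/funext => Z; apply/ffunP => I; rewrite !ffunE /= !mxE.
have pn := count0_le I; set p := count_mem 0%R I in pn *.
have ltk : (i + p < (m + n).+1)%N by have := ltn_ord i; lia.
rewrite (bigD1 (Ordinal ltk))//= big1 ?addr0 => [|k /eqP ki]; last first.
  rewrite deriv_mxE -/p; case: eqP => [e|]; last by rewrite !mul0r.
  by case: ki; apply/val_inj.
rewrite deriv_mxE -/p /= eqxx mul1r -(tcoef_Vrep (Ordinal ltk)) /=.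
by rewrite [RHS]mulrCA [RHS]mulrA.
Qed.

Lemma Gminus_entry m (i : 'I_m.+1) (j : 'I_(m + n).+1) :
  Gminus_fun n m i j = entry_fun
    (fun Z I => (\det Z)^-1 *: (Vrep (m + n) (invmx Z) *m shift_mx R m I)) j i.
Proof.
apply/funext => Z; apply/ffunP => I; rewrite !ffunE /= !mxE.
have pn := count0_le I; set p := count_mem 0%R I in pn *.
have ltk : (i + p < (m + n).+1)%N by have := ltn_ord i; lia.
rewrite (bigD1 (Ordinal ltk))//= big1 ?addr0 => [|k /eqP ki]; last first.
  rewrite [shift_mx _ _ _ _ _]mxE -/p; case: eqP => [e|]; last by rewrite mulr0.
  by case: ki; apply/val_inj.
by rewrite [shift_mx _ _ _ _ _]mxE -/p /= eqxx mulr1 -(tcoef_Vrep j (Ordinal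
  ltk)).
Qed.

End Families.

(** * Transformation rules, degrees and assembly of the decompositions *)

Section Actions.
Variables (R : realType) (n : nat).
Local Notation C := R[i].
Implicit Types (I J : n.-tuple 'I_2).

Lemma tensl_linear (d : 'M[C]_2) : linear (@tensl R n d).
Proof.
move=> c v w; apply/ffunP => I; rewrite !ffunE scaler_sumr -big_split.
by apply: eq_bigr => J _; rewrite !ffunE mulrDr; congr (_ + _); exact: mulrCA.
Qed.

Lemma tensr_linear (a : 'M[C]_2) : linear (fun v => @tensr R n v a).
Proof.
move=> c v w; apply/ffunP => J; rewrite !ffunE scaler_sumr -big_split.
by apply: eq_bigr => I _; rewrite !ffunE mulrDl; congr (_ + _); rewrite -mulrA.
Qed.

Lemma pi_nl_linear (a d : 'M[C]_2) : linear (pi_nl R n a d).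
Proof. by move=> c f g; apply/funext => Z; exact: tensl_linear. Qed.

Lemma pi_nr_linear (a d : 'M[C]_2) : linear (pi_nr R n a d).
Proof. by move=> c f g; apply/funext => Z; exact: tensr_linear. Qed.

Lemma entry_fun_mulmx r s (K : 'M[C]_2 -> n.-tuple 'I_2 -> 'M[C]_(r, s))
    (A : 'M[C]_r) (B : 'M[C]_s) i j :
  entry_fun (fun Z I => A *m K Z I *m B) i j =
  \sum_i' \sum_j' (A i i' * B j' j) *: entry_fun K i' j'.
Proof.
apply/funext => Z; apply/ffunP => I; rewrite ffunE fct_sumE sum_ffunE mxE.
under eq_bigr do rewrite mxE mulr_suml.
rewrite exchange_big; apply: eq_bigr => i' _; rewrite fct_sumE sum_ffunE.
apply: eq_bigr => j' _; rewrite mulrAC.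
have scaleE (x : C) (f : 'M[C]_2 -> tens R n) : (x *: f) Z I = x * f Z I.
  by rewrite -[LHS]/((x *: f Z) I) ffunE.
by rewrite scaleE ffunE.
Qed.

Lemma pi_nl_entry_fun r s (K K' : 'M[C]_2 -> n.-tuple 'I_2 -> 'M[C]_(r, s))
    (a d : 'M[C]_2) i j :
  (forall Z I, \sum_J (\prod_(k < n) d (tnth I k) (tnth J k)) *:
     K (invmx a *m Z *m d) J = K' Z I) ->
  pi_nl R n a d (entry_fun K i j) = entry_fun K' i j.
Proof.
move=> KK'; apply/funext => Z; apply/ffunP => I; rewrite !ffunE -KK' summxE.
by apply: eq_bigr => J _; rewrite !ffunE mxE.
Qed.

Lemma pi_nr_entry_fun r s (K K' : 'M[C]_2 -> n.-tuple 'I_2 -> 'M[C]_(r, s))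
    (a d : 'M[C]_2) i j :
  (forall Z J, \sum_I (\prod_(k < n) invmx a (tnth I k) (tnth J k)) *:
     K (invmx a *m Z *m d) I = K' Z J) ->
  pi_nr R n a d (entry_fun K i j) = entry_fun K' i j.
Proof.
move=> KK'; apply/funext => Z; apply/ffunP => J; rewrite !ffunE -KK' summxE.
by apply: eq_bigr => I _; rewrite !ffunE mxE mulrC.
Qed.

Lemma SU2_unit (a : 'M[C]_2) : SU2 a -> a \in unitmx.
Proof. by move=> [_ da]; rewrite unitmxE da unitr1. Qed.

(** [deriv_Vrep] read from right to left: the tensor action of [d], together with the factor
    [Vrep m d] from the argument, becomes right multiplication by [Vrep (m + n) d]. *)
Lemma pi_nl_Fplus m (a d : 'M[C]_2) i j :
  pi_nl R n a d (entry_fun (fun Z I => Vrep m Z *m deriv_mx R m I) i j) =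
  entry_fun (fun Z I => Vrep m (invmx a) *m (Vrep m Z *m deriv_mx R m I) *m
                        Vrep (m + n) d) i j.
Proof.
apply: pi_nl_entry_fun => Z I; rewrite -!mulmxA deriv_Vrep !mulmx_sumr.
by apply: eq_bigr => J _; rewrite -!scalemxAr !VrepM -!mulmxA.
Qed.

Lemma pi_nr_Gplus m (a d : 'M[C]_2) i j :
  pi_nr R n a d (entry_fun (fun Z I => shift_mx R m I *m Vrep m Z) i j) =
  entry_fun (fun Z I => Vrep (m + n) (invmx a) *m (shift_mx R m I *m Vrep m Z)
    *m
                        Vrep m d) i j.
Proof.
apply: pi_nr_entry_fun => Z I; rewrite !mulmxA Vrep_shift !mulmx_suml.
by apply: eq_bigr => J _; rewrite -!scalemxAl !VrepM -!mulmxA.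
Qed.

Lemma invmx_conj (a d Z : 'M[C]_2) : SU2 a -> SU2 d -> Z \in unitmx ->
  invmx (invmx a *m Z *m d) = invmx d *m invmx Z *m a.
Proof.
move=> /SU2_unit ua /SU2_unit ud uZ.
have u1 : invmx a *m Z \in unitmx by rewrite unitmx_mul unitmx_inv ua.
have u2 : invmx a *m Z *m d \in unitmx by rewrite unitmx_mul u1.
apply: (can_inj (mulKmx u2)); rewrite mulmxV// !mulmxA mulmxK// -!mulmxA.
by rewrite mulKVmx// mulVmx.
Qed.

Lemma det_conj (a d Z : 'M[C]_2) : SU2 a -> SU2 d ->
  \det (invmx a *m Z *m d) = \det Z.
Proof. by move=> [_ da] [_ dd]; rewrite !det_mulmx det_inv da dd invr1 mul1r
  mulr1. Qed.

(** Solved for the tensor action, [deriv_Vrep] yields a factor [Vrep (m + n) d] that cancels the one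
    from the inverted argument d^-1 Z^-1 a; hence [d] now acts on the left and [a] on the right. *)
Lemma pi_nl_Fminus m (a d : 'M[C]_2) i j : SU2 a -> SU2 d ->
  pi_nl R n a d (entry_fun
    (fun Z I => (\det Z)^-1 *: (deriv_mx R m I *m Vrep (m + n) (invmx Z))) i j)
      =
  entry_fun (fun Z I => Vrep m (invmx d) *m
    ((\det Z)^-1 *: (deriv_mx R m I *m Vrep (m + n) (invmx Z))) *m
    Vrep (m + n) a) i j.
Proof.
move=> sa sd; apply: pi_nl_entry_fun => Z I; rewrite det_conj//.
under eq_bigr do rewrite scalerA mulrC -scalerA.
rewrite -scaler_sumr -scalemxAr -scalemxAl.
(* On singular matrices both sides are the extension by zero. *)
have [->|Z0] := eqVneq (\det Z) 0; first by rewrite invr0 !scale0r.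
have uZ : Z \in unitmx by rewrite unitmxE unitfE.
congr (_ *: _); rewrite (invmx_conj sa sd uZ).
have S : \sum_J (\prod_(k < n) d (tnth I k) (tnth J k)) *: deriv_mx R m J =
    Vrep m (invmx d) *m deriv_mx R m I *m Vrep (m + n) d.
  rewrite -mulmxA deriv_Vrep mulmx_sumr; apply: eq_bigr => J _.
  by rewrite -scalemxAr mulmxA -VrepM (mulVmx (SU2_unit sd)) Vrep1 mul1mx.
under eq_bigr do rewrite scalemxAl.
rewrite -mulmx_suml S !VrepM !mulmxA -[_ *m Vrep _ d *m _]mulmxA -VrepM.
by rewrite (mulmxV (SU2_unit sd)) Vrep1 mulmx1.
Qed.

Lemma pi_nr_Gminus m (a d : 'M[C]_2) i j : SU2 a -> SU2 d ->
  pi_nr R n a d (entry_fun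
    (fun Z I => (\det Z)^-1 *: (Vrep (m + n) (invmx Z) *m shift_mx R m I)) i j)
      =
  entry_fun (fun Z I => Vrep (m + n) (invmx d) *m
    ((\det Z)^-1 *: (Vrep (m + n) (invmx Z) *m shift_mx R m I)) *m
    Vrep m a) i j.
Proof.
move=> sa sd; apply: pi_nr_entry_fun => Z I; rewrite det_conj//.
under eq_bigr do rewrite scalerA mulrC -scalerA.
rewrite -scaler_sumr -scalemxAr -scalemxAl.
have [->|Z0] := eqVneq (\det Z) 0; first by rewrite invr0 !scale0r.
have uZ : Z \in unitmx by rewrite unitmxE unitfE.
congr (_ *: _); rewrite (invmx_conj sa sd uZ).
have S : \sum_J (\prod_(k < n) invmx a (tnth J k) (tnth I k)) *: shift_mx R m J
  =
    Vrep (m + n) (invmx a) *m shift_mx R m I *m Vrep m a.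
  rewrite Vrep_shift mulmx_suml; apply: eq_bigr => J _.
  by rewrite -scalemxAl -mulmxA -VrepM (mulVmx (SU2_unit sa)) Vrep1 mulmx1.
under eq_bigr do rewrite scalemxAr.
rewrite -mulmx_sumr S !VrepM !mulmxA -[_ *m Vrep _ a *m _]mulmxA -(VrepM _ a).
by rewrite (mulmxV (SU2_unit sa)) Vrep1 mulmx1.
Qed.

(** Only the side that transforms by the inverse needs the invariant form; on the other the
    coefficients already transform by [Vrep s d]. *)
Lemma realizes_inv_first (V : lmodType C) (act : 'M[C]_2 -> 'M[C]_2 -> V -> V)
    r s (g : 'I_r.+1 -> 'I_s.+1 -> V) :
  (forall a d, linear (act a d)) ->
  (forall a d, SU2 a -> SU2 d -> forall i j, act a d (g i j) =
    \sum_i' \sum_j' (Vrep r (invmx a) i i' * Vrep s d j' j) *: g i' j') ->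
  (exists i j, g i j != 0) ->
  realizes act r s (range (combination g)).
Proof.
move=> act_lin actg g0.
apply: (realizes_combination act_lin (A := fun a => Vrep r (invmx a))
  (B := fun d => (Vrep s d)^T) (P := invariant_form R r) (Q := 1%:M)) => //.
- move=> a d sa sd i j; rewrite actg//.
  by apply: eq_bigr => i' _; apply: eq_bigr => j' _; rewrite [_^T _ _]mxE.
- exact: invariant_form_unit.
- exact: unitmx1.
- by move=> a [_ da]; rewrite invariant_formE ?invmxK// det_inv da invr1.
- by move=> d _; rewrite trmxK mulmx1 mul1mx.
Qed.

Lemma combination_tr (V : lmodType C) r s (g : 'I_r -> 'I_s -> V) :
  range (combination g) = range (combination (fun j i => g i j)).
Proof.
have sub r' s' (g' : 'I_r' -> 'I_s' -> V) :
    range (combination g') `<=` range (combination (fun j i => g' i j)).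
  move=> _ [X _ <-]; exists X^T => //; rewrite /combination exchange_big /=.
  by apply: eq_bigr => i _; apply: eq_bigr => j _; rewrite mxE.
by apply/seteqP; split; exact: sub.
Qed.

Lemma realizes_inv_second (V : lmodType C) (act : 'M[C]_2 -> 'M[C]_2 -> V -> V)
    r s (g : 'I_r.+1 -> 'I_s.+1 -> V) :
  (forall a d, linear (act a d)) ->
  (forall a d, SU2 a -> SU2 d -> forall i j, act a d (g i j) =
    \sum_i' \sum_j' (Vrep r (invmx d) i i' * Vrep s a j' j) *: g i' j') ->
  (exists i j, g i j != 0) ->
  realizes act s r (range (combination g)).
Proof.
move=> act_lin actg [i0 [j0 g0]]; rewrite combination_tr.
apply: (realizes_combination act_lin (A := fun a => (Vrep s a)^T)
  (B := fun d => Vrep r (invmx d)) (P := 1%:M) (Q := invariant_form R r)).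
- move=> a d sa sd i j; rewrite actg// exchange_big.
  by apply: eq_bigr => i' _; apply: eq_bigr => j' _; rewrite [_^T _ _]mxE mulrC.
- exact: unitmx1.
- exact: invariant_form_unit.
- by move=> d _; rewrite trmxK mulmx1 mul1mx.
- by move=> a [_ da]; rewrite invariant_formE ?invmxK// det_inv da invr1.
- by exists j0, i0.
Qed.

Lemma entry_fun_neq0 r s (K : 'M[C]_2 -> n.-tuple 'I_2 -> 'M[C]_(r, s)) Z I i j
  :
  K Z I i j != 0 -> entry_fun K i j != 0.
Proof.
move=> Kij; apply/eqP => /(congr1 (fun f : 'M[C]_2 -> tens R n => f Z I)).
by rewrite !ffunE => K0; rewrite K0 eqxx in Kij.
Qed.

(** With p = 0 the first diagonal entries of [shift_mx] and [deriv_mx] are nonzero; evaluation at Z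
    = 1 then exhibits a nonzero member of each family. *)
Let I1 : n.-tuple 'I_2 := nseq_tuple n 1.

Lemma count_I1 : count_mem 0%R I1 = 0%N.
Proof. by rewrite /= count_nseq. Qed.

Lemma fact_neq0 k : k`!%:R != 0 :> C.
Proof. by rewrite pnatr_eq0 -lt0n fact_gt0. Qed.

Lemma deriv_mx0 m : deriv_mx R m I1 ord0 ord0 != 0.
Proof.
rewrite deriv_mxE count_I1 /= mul1r !mulf_neq0 ?invr_eq0 ?fact_neq0//.
Qed.

Lemma shift_mx0 m : shift_mx R m I1 ord0 ord0 != 0.
Proof. by rewrite mxE count_I1 oner_eq0. Qed.

Lemma realizes_Fplus m :
  realizes (pi_nl R n) m (m + n) (family_component (@Fplus_fun R n) m).
Proof.
rewrite /family_component.
apply: realizes_inv_first; first exact: pi_nl_linear.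
- move=> a d sa sd i j; rewrite Fplus_entry pi_nl_Fplus entry_fun_mulmx.
  by apply: eq_bigr => i' _; apply: eq_bigr => j' _; rewrite Fplus_entry.
- exists ord0, ord0; rewrite Fplus_entry; apply: (entry_fun_neq0 (Z := 1%:M) (I
  := I1)).
  by rewrite Vrep1 mul1mx deriv_mx0.
Qed.

Lemma realizes_Fminus m :
  realizes (pi_nl R n) (m + n) m (family_component (@Fminus_fun R n) m).
Proof.
rewrite /family_component.
apply: realizes_inv_second; first exact: pi_nl_linear.
- move=> a d sa sd i j; rewrite Fminus_entry pi_nl_Fminus// entry_fun_mulmx.
  by apply: eq_bigr => i' _; apply: eq_bigr => j' _; rewrite Fminus_entry.
- exists ord0, ord0; rewrite Fminus_entry; apply: (entry_fun_neq0 (Z := 1%:M) (I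
  := I1)).
  by rewrite det1 invr1 scale1r invmx1 Vrep1 mulmx1 deriv_mx0.
Qed.

Lemma realizes_Gplus m :
  realizes (pi_nr R n) (m + n) m (family_component (@Gplus_fun R n) m).
Proof.
rewrite /family_component combination_tr.
apply: realizes_inv_first; first exact: pi_nr_linear.
- move=> a d sa sd i j; rewrite Gplus_entry pi_nr_Gplus entry_fun_mulmx.
  by apply: eq_bigr => i' _; apply: eq_bigr => j' _; rewrite Gplus_entry.
- exists ord0, ord0; rewrite Gplus_entry; apply: (entry_fun_neq0 (Z := 1%:M) (I
  := I1)).
  by rewrite Vrep1 mulmx1 shift_mx0.
Qed.

Lemma realizes_Gminus m :
  realizes (pi_nr R n) m (m + n) (family_component (@Gminus_fun R n) m).
Proof.
rewrite /family_component combination_tr.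
apply: realizes_inv_second; first exact: pi_nr_linear.
- move=> a d sa sd i j; rewrite Gminus_entry pi_nr_Gminus// entry_fun_mulmx.
  by apply: eq_bigr => i' _; apply: eq_bigr => j' _; rewrite Gminus_entry.
- exists ord0, ord0; rewrite Gminus_entry; apply: (entry_fun_neq0 (Z := 1%:M) (I
  := I1)).
  by rewrite det1 invr1 scale1r invmx1 Vrep1 mul1mx shift_mx0.
Qed.

Lemma entry_fun_homogeneous r s (K : 'M[C]_2 -> n.-tuple 'I_2 -> 'M[C]_(r, s))
    (c x : C) (Z : 'M[C]_2) i j :
  (forall I, K (c *: Z) I = x *: K Z I) ->
  entry_fun K i j (c *: Z) = x *: entry_fun K i j Z.
Proof. by move=> Kc; apply/ffunP => I; rewrite !ffunE Kc mxE. Qed.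

(** The determinant accounts for the exponent -2, the inverse matrix for -(m + n). *)
Lemma scaled_inverse_degree m (c : C) (Z : 'M[C]_2) : c != 0 ->
  (\det (c *: Z))^-1 *: Vrep (m + n) (invmx (c *: Z)) =
  c ^ (- m%:Z - n%:Z - 2) *: ((\det Z)^-1 *: Vrep (m + n) (invmx Z)).
Proof.
move=> c0; rewrite detZ; have [Z0|Z0] := eqVneq (\det Z) 0.
  by rewrite Z0 mulr0 invr0 !scale0r scaler0.
rewrite invmxZ; last by rewrite unitmxE unitfE detZ mulf_neq0// expf_neq0.
rewrite VrepZ !scalerA; congr (_ *: _).
have -> : c ^ (- m%:Z - n%:Z - 2) = (c ^+ (m + n + 2))^-1.
  by rewrite exprnN; congr (c ^ _); lia.
by rewrite exprVn -!invfM [c ^+ (m + n + 2)]exprD mulrC mulrA.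
Qed.

Lemma Fplus_homogeneous m i j : (i <= m)%N -> (j <= m + n)%N ->
  forall (c : C) (Z : 'M[C]_2), c != 0 ->
  Fplus_fun n m i j (c *: Z) = c ^ m%:Z *: Fplus_fun n m i j Z.
Proof.
rewrite -ltnS -[(j <= _)%N]ltnS => im jm c Z _.
rewrite (Fplus_entry R (Ordinal im) (Ordinal jm)).
by apply: entry_fun_homogeneous => I; rewrite VrepZ -scalemxAl.
Qed.

Lemma Gplus_homogeneous m i j : (i <= m)%N -> (j <= m + n)%N ->
  forall (c : C) (Z : 'M[C]_2), c != 0 ->
  Gplus_fun n m i j (c *: Z) = c ^ m%:Z *: Gplus_fun n m i j Z.
Proof.
rewrite -ltnS -[(j <= _)%N]ltnS => im jm c Z _.
rewrite (Gplus_entry R (Ordinal im) (Ordinal jm)).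
by apply: entry_fun_homogeneous => I; rewrite VrepZ -scalemxAr.
Qed.

Lemma Fminus_homogeneous m i j : (i <= m)%N -> (j <= m + n)%N ->
  forall (c : C) (Z : 'M[C]_2), c != 0 ->
  Fminus_fun n m i j (c *: Z) = c ^ (- m%:Z - n%:Z - 2) *: Fminus_fun n m i j Z.
Proof.
rewrite -ltnS -[(j <= _)%N]ltnS => im jm c Z c0.
rewrite (Fminus_entry R (Ordinal im) (Ordinal jm)).
apply: entry_fun_homogeneous => I.
by rewrite !scalemxAr scaled_inverse_degree.
Qed.

Lemma Gminus_homogeneous m i j : (i <= m)%N -> (j <= m + n)%N ->
  forall (c : C) (Z : 'M[C]_2), c != 0 ->
  Gminus_fun n m i j (c *: Z) = c ^ (- m%:Z - n%:Z - 2) *: Gminus_fun n m i j Z.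
Proof.
rewrite -ltnS -[(j <= _)%N]ltnS => im jm c Z c0.
rewrite (Gminus_entry R (Ordinal im) (Ordinal jm)).
apply: entry_fun_homogeneous => I.
by rewrite !scalemxAl scaled_inverse_degree.
Qed.

Lemma family_decomposition (act : 'M[C]_2 -> 'M[C]_2 -> ('M[C]_2 -> tens R n) ->
  'M[C]_2 -> tens R n)
    (F : nat -> nat -> nat -> 'M[C]_2 -> tens R n) (deg : nat -> int) (r s : nat
      -> nat) :
  (forall a d, linear (act a d)) -> injective deg ->
  (forall m i j, (i <= m)%N -> (j <= m + n)%N ->
    forall (c : C) (Z : 'M[C]_2), c != 0 -> F m i j (c *: Z) = c ^ deg m *: F m
      i j Z) ->
  (forall m, realizes act (r m) (s m) (family_component F m)) ->
  [/\ forall d, act_invariant act (homogeneous_part (family_span F) d),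
      forall m, irreducible_rep act (homogeneous_part (family_span F) (deg m))
        /\
        iso_boxtimes act (r m) (s m) (homogeneous_part (family_span F) (deg m))
          &
      forall d, (forall m, deg m != d) -> homogeneous_part (family_span F) d =
        [set 0]].
Proof.
move=> act_lin deg_inj Fhom Freal; split => [d|m|d dd].
(* A degree that is no [deg m] has zero homogeneous part, which is invariant by linearity of the
   action. *)
- have [[m <-]|/forallNP dd] := pselect (exists m, deg m = d).
    by rewrite (homogeneous_part_component deg_inj Fhom); have [] := Freal m.
  rewrite (homogeneous_part0 deg_inj Fhom) => [|m]; last exact/eqP.
  move=> a b _ _ _ ->.
  have := act_lin a b 1 0 0; rewrite !scale1r addr0 => /eqP.
  by rewrite -subr_eq0 opprD addNKr oppr_eq0 => /eqP.
- by rewrite (homogeneous_part_component deg_inj Fhom); have [] := Freal m.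
- exact: homogeneous_part0 deg_inj Fhom _ dd.
Qed.

End Actions.

Unset Implicit Arguments.

Theorem proposition24 (R : realType) (n : nat) (n_ge1 : (1 <= n)%N) :
  [/\ forall d : int,
        act_invariant (pi_nl R n) (homogeneous_part (calFplus R n) d) /\
        act_invariant (pi_nl R n) (homogeneous_part (calFminus R n) d),
      (forall m : nat,
         irreducible_rep (pi_nl R n) (homogeneous_part (calFplus R n) m%:Z) /\
         iso_boxtimes (pi_nl R n) m (m + n)
           (homogeneous_part (calFplus R n) m%:Z)) /\
      (forall d : int, d < 0 ->
         homogeneous_part (calFplus R n) d = [set 0])
    & (forall m : nat,
         irreducible_rep (pi_nl R n)
           (homogeneous_part (calFminus R n) (- m%:Z - n%:Z - 2)) /\
         iso_boxtimes (pi_nl R n) (m + n) m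
           (homogeneous_part (calFminus R n) (- m%:Z - n%:Z - 2))) /\
      (forall d : int, - (n%:Z + 2) < d ->
         homogeneous_part (calFminus R n) d = [set 0])] /\
  [/\ forall d : int,
        act_invariant (pi_nr R n) (homogeneous_part (calGplus R n) d) /\
        act_invariant (pi_nr R n) (homogeneous_part (calGminus R n) d),
      (forall m : nat,
         irreducible_rep (pi_nr R n) (homogeneous_part (calGplus R n) m%:Z) /\
         iso_boxtimes (pi_nr R n) (m + n) m
           (homogeneous_part (calGplus R n) m%:Z)) /\
      (forall d : int, d < 0 ->
         homogeneous_part (calGplus R n) d = [set 0])
    & (forall m : nat,
         irreducible_rep (pi_nr R n)
           (homogeneous_part (calGminus R n) (- m%:Z - n%:Z - 2)) /\
         iso_boxtimes (pi_nr R n) m (m + n)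
           (homogeneous_part (calGminus R n) (- m%:Z - n%:Z - 2))) /\
      (forall d : int, - (n%:Z + 2) < d ->
         homogeneous_part (calGminus R n) d = [set 0])].
Proof.
have plus_inj : injective (fun m : nat => m%:Z) by move=> ? ? [].
have minus_inj : injective (fun m : nat => - m%:Z - n%:Z - 2 : int).
  by move=> a b /addIr/addIr/oppr_inj[].
have [F1 F2 F3] := family_decomposition (@pi_nl_linear R n) plus_inj
  (@Fplus_homogeneous R n) (@realizes_Fplus R n).
have [F4 F5 F6] := family_decomposition (@pi_nl_linear R n) minus_inj
  (@Fminus_homogeneous R n) (@realizes_Fminus R n).
have [G1 G2 G3] := family_decomposition (@pi_nr_linear R n) plus_inj
  (@Gplus_homogeneous R n) (@realizes_Gplus R n).
have [G4 G5 G6] := family_decomposition (@pi_nr_linear R n) minus_inj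
  (@Gminus_homogeneous R n) (@realizes_Gminus R n).
have plus_deg (d : int) : d < 0 -> forall m : nat, m%:Z != d.
  by move=> d0 m; apply: contraL d0 => /eqP <-; rewrite -leNgt.
have minus_deg (d : int) : - (n%:Z + 2) < d ->
    forall m : nat, - m%:Z - n%:Z - 2 != d.
  (* The degrees decrease in [m], and the largest, at [m = 0], is -(n + 2). *)
  by move=> d0 m; apply/eqP => e; move: d0; rewrite -e; lia.
split; split.
- by move=> d; split; [exact: F1|exact: F4].
- by split=> [|d /plus_deg]; [exact: F2|exact: F3].
- by split=> [|d /minus_deg]; [exact: F5|exact: F6].
- by move=> d; split; [exact: G1|exact: G4].
- by split=> [|d /plus_deg]; [exact: G2|exact: G3].
- by split=> [|d /minus_deg]; [exact: G5|exact: G6].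
Qed.
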